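(* Let $\mathcal{M}=(G,\{1\},\{j\},V)$ be a linear compartmental model (with a leak in every compartment) that has expected dimension, where $|V|=n$ (with $V=\{1,\ldots,n\}$) and $j\neq 1$. Let $G'$ be the graph obtained from $G$ by adding new vertices $n+1,n+2,\ldots,n+k$ and edges $n+1\to 1,\ n+2\to n+1,\ \ldots,\ n+k\to n+(k-1)$, and make $n+k$ the new input vertex. Then the model $\widetilde{\mathcal{M}}=(G',\{n+k\},\{j\},V\cup\{n+1,\ldots,n+k\})$ also has expected dimension.
   Context: A linear compartmental model $(G,In,Out,Leak)$ consists of a finite directed graph $G=(V,E)$ (no self-loops, no repeated edges) and subsets $In,Out,Leak\subseteq V$ (input, output and leak compartments; $In,Out$ nonempty). Each edge $j\to i$ carries an independent parameter $a_{ij}$ and each $i\in Leak$ an independent parameter $a_{0i}$. The compartmental matrix $A$ has $A_{ij}=a_{ij}$ if $j\to i\in E$; $A_{ii}=-a_{0i}-\sum_{k:\,i\to k\in E}a_{ki}$ if $i\in Leak$; $A_{ii}=-\sum_{k:\,i\to k\in E}a_{ki}$ if $i\notin Leak$; all other entries $0$. The model is the system $x'=Ax+u$, $y_i=x_i$ for $i\in Out$, with $u_i\equiv 0$ for $i\notin In$. When $Leak=V$, the diagonal entries $a_{ii}:=A_{ii}$ are algebraically independent and are used as parameters in place of the $a_{0i}$. For an output $j$ reachable by a directed path from some input, let $H$ be the induced subgraph on all vertices having a directed path to $j$ (the output-reachable subgraph), and $A_H$ the submatrix of $A$ with rows and columns indexed by $H$. The input-output equation for $y_j$ is $\det(\partial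 I-A_H)\,y_j=\sum_{i\in In\cap V_H}(-1)^{i+j}\det(\partial I-A_H)_{ij}\,u_i$, where $\partial=d/dt$ and $(\cdot)_{ij}$ means delete the row of $i$ and the column of $j$; if every vertex has a directed path to $j$, then $H=G$ and $A_H=A$. The coefficient map $c$ from $\mathbb{R}^{|E|+|Leak|}$ collects all nonzero, nonmonic coefficients (polynomials in the parameters) of these equations over all $j\in Out$. A model $(G,In,Out,V)$ has expected dimension if the dimension of the image of its coefficient map is maximal, namely equal to $|E|+|In\cup Out|$ (here $|E|+2$, with $E$ the edge set of the graph of the model in question). *)

(* Defs.v *)
From mathcomp Require Import all_boot all_order all_algebra.
From mathcomp Require Import reals.
From mathcomp Require Import mpoly.

Set Implicit Arguments.
Unset Strict Implicit.
Unset Printing Implicit Defensive.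

Import GRing.Theory.
Local Open Scope ring_scope.

Record digraph (n : nat) := Digraph {
  arc :> rel 'I_n;
  arc_irr : irreflexive arc
}.

Definition edges (n : nat) (G : digraph n) : {set 'I_n * 'I_n} :=
  [set e | G e.1 e.2].

Record model (n : nat) := Model {
  graph : digraph n;
  inp : {set 'I_n};
  outp : {set 'I_n};
  leak : {set 'I_n};
  inp_neq0 : inp != set0;
  outp_neq0 : outp != set0
}.

(* The edge (u, v) stands for u -> v; its parameter is a_vu. *)
Definition param (n : nat) (M : model n) : finType :=
  ({e : 'I_n * 'I_n | e \in edges (graph M)} + {i : 'I_n | i \in leak M})%type.

Lemma card_param (n : nat) (M : model n) :
  #|param M| = (#|edges (graph M)| + #|leak M|)%N.
Proof. by rewrite card_sum !card_sig. Qed.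

Notation param_ring R M := {mpoly R[#|param M|]}.

(* a_ij if j -> i is an edge, and 0 otherwise *)
Definition edge_param (R : realType) (n : nat) (M : model n)
    (i j : 'I_n) : param_ring R M :=
  if insub (j, i) is Some e then 'X_(enum_rank (inl e : param M)) else 0.

(* a_0i if i is a leak compartment, and 0 otherwise *)
Definition leak_param (R : realType) (n : nat) (M : model n)
    (i : 'I_n) : param_ring R M :=
  if insub i is Some l then 'X_(enum_rank (inr l : param M)) else 0.

Definition compartmental_mx (R : realType) (n : nat) (M : model n) :
    'M[param_ring R M]_n :=
  \matrix_(i, j)
    if i == j
    then - leak_param R M i - \sum_(k | graph M i k) edge_param R M k i
    else edge_param R M i j.

Definition output_reachable (n : nat) (M : model n) (j : 'I_n) : {set 'I_n} :=
  [set v | connect (graph M) v j].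

Lemma mem_output_reachable (n : nat) (M : model n) (j : 'I_n) :
  j \in output_reachable M j.
Proof. by rewrite inE connect0. Qed.

Definition reach_pos (n : nat) (M : model n) (j i : 'I_n) :
    'I_#|output_reachable M j| :=
  enum_rank_in (mem_output_reachable M j) i.

Definition reach_mx (R : realType) (n : nat) (M : model n) (j : 'I_n) :
    'M[param_ring R M]_#|output_reachable M j| :=
  mxsub enum_val enum_val (compartmental_mx R M).

(* The differential operators in the input-output equation of y_j, as
   polynomials in the derivation d/dt.  cofactor s t B is the determinant of B
   without row s and column t, with its sign; s and t are positions within
   the output-reachable subgraph. *)
Definition io_lhs (R : realType) (n : nat) (M : model n) (j : 'I_n) :
    {poly param_ring R M} :=
  char_poly (reach_mx R M j).

Definition io_rhs (R : realType) (n : nat) (M : model n)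
    (j i : 'I_n) : {poly param_ring R M} :=
  cofactor (char_poly_mx (reach_mx R M j)) (reach_pos M j i) (reach_pos M j j).

Definition io_coeffs (R : realType) (n : nat) (M : model n) (j : 'I_n) :
    seq (param_ring R M) :=
  (io_lhs R M j : seq (param_ring R M)) ++
  flatten [seq (io_rhs R M j i : seq (param_ring R M))
             | i <- enum (inp M :&: output_reachable M j)].

Definition has_io_equation (n : nat) (M : model n) (j : 'I_n) : bool :=
  (j \in outp M) && [exists i in inp M, connect (graph M) i j].

(* q != 1 drops the leading coefficients of the monic operators, that is of
   io_lhs and of io_rhs j j; the other coefficients have no constant term. *)
Definition coeffs (R : realType) (n : nat) (M : model n) :
    seq (param_ring R M) :=
  [seq q <- flatten [seq io_coeffs R M j | j <- enum (has_io_equation M)]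
     | (q != 0) && (q != 1)].

Definition coeff_map (R : realType) (n : nat) (M : model n)
    (a : 'I_#|param M| -> R) : 'I_(size (coeffs R M)) -> R :=
  fun s => (tnth (in_tuple (coeffs R M)) s).@[a].

Definition coeff_image (R : realType) (n : nat) (M : model n)
    (x : 'I_(size (coeffs R M)) -> R) : Prop :=
  exists a : 'I_#|param M| -> R, x = coeff_map a.

(* The polynomial functions f_0, ..., f_(d-1) restricted to S are algebraically
   independent over R. *)
Definition alg_indep_on (R : realType) (N : nat) (S : ('I_N -> R) -> Prop)
    (d : nat) (f : 'I_d -> {mpoly R[N]}) : Prop :=
  forall P : {mpoly R[d]},
    (forall x, S x -> P.@[fun i => (f i).@[x]] = 0) -> P = 0.

(* S has dimension d: the ring of polynomial functions on S, which is the
   coordinate ring of its Zariski closure, has transcendence degree d over R. *)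
Definition has_dim (R : realType) (N : nat) (S : ('I_N -> R) -> Prop)
    (d : nat) : Prop :=
  (exists f : 'I_d -> {mpoly R[N]}, alg_indep_on S f) /\
  (forall (e : nat) (f : 'I_e -> {mpoly R[N]}), alg_indep_on S f -> (e <= d)%N).

Definition expected_dimension (R : realType) (n : nat) (M : model n) : Prop :=
  has_dim (@coeff_image R n M)
    (#|edges (graph M)| + #|inp M :|: outp M|)%N.

Lemma set1_neq0 (n : nat) (i : 'I_n) : [set i] != set0.
Proof. by apply/set0Pn; exists i; rewrite set11. Qed.

(* (G, {i}, {j}, V).  The parameters stay a_0i rather than a_ii: the two
   parametrizations differ by an invertible linear change of coordinates, so
   the coefficient map has the same image. *)
Definition full_leak_model (n : nat) (G : digraph n) (i j : 'I_n) : model n :=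
  Model G [set: 'I_n] (set1_neq0 i) (set1_neq0 j).

(* G is kept on the vertices lshift k v; the path is
   rshift n.+1 (k-1) -> ... -> rshift n.+1 1 -> rshift n.+1 0 -> lshift k ord0. *)
Definition chain_arc (n k : nat) (G : digraph n.+1) : rel 'I_(n.+1 + k) :=
  fun u v =>
    match split u, split v with
    | inl a, inl b => G a b
    | inr s, inl b => (s == 0 :> nat) && (b == ord0)
    | inr s, inr t => s == t.+1 :> nat
    | inl _, inr _ => false
    end.

Lemma chain_arc_irr (n k : nat) (G : digraph n.+1) :
  irreflexive (@chain_arc n k G).
Proof.
move=> u; rewrite /chain_arc; case: (split u) => [a|s]; first exact: arc_irr.
by rewrite ltn_eqF.
Qed.

Definition chain_graph (n k : nat) (G : digraph n.+1) : digraph (n.+1 + k) :=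
  Digraph (@chain_arc_irr n k G).

(* Main.v *)
From HB Require Import structures.
Require Import Defs.
From mathcomp Require Import all_boot all_order all_algebra fingroup perm.
From mathcomp Require Import boolp reals.
From mathcomp Require Import mpoly.

(** Let [p] be the characteristic polynomial of the compartmental matrix of the
    output-reachable subgraph of [G], and [q] the cofactor that gives the
    right-hand side of the input-output equation. For the model with the path
    prepended, the two operators are [p * \prod_s ('X - d_s)] and [c * q], where
    the [d_s] are the diagonal entries of the new vertices and [c] is the
    product of the new edge parameters ([char_poly_chain] and [cofactor_chain],
    which need only the case where these parameters are 1).

    The dimension of the image of a polynomial map is the transcendence degree
    of the field generated by its coordinates ([has_dim_image]). The factor [c]
    does not change it: rescaling the states, with equal factors at the input
    and at the output, makes all the new edge parameters equal to 1 wherever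
    they are nonzero, and does not change the input-output equation
    ([rescaledE], [coeffs_rescale]); and a proper closed subset of the parameter
    space does not matter ([has_dim_dense]). The [d_s] are independent of [p]
    and [q], and they are roots of [p * \prod_s ('X - d_s)]; hence they are
    algebraic over its coefficients, and so are the coefficients of the
    quotient [p]. So the transcendence degree grows by exactly the number of
    new vertices ([tbasis_mul_linear]), which is also the number of new edges
    ([card_chain_edges]).

    The facts on transcendence degree come from the exchange property of
    algebraic closure ([cl_exchange], [steinitz]). *)

Set Implicit Arguments.
Unset Strict Implicit.
Unset Printing Implicit Defensive.

Import GRing.Theory Num.Theory.
Local Open Scope ring_scope.

(** * Relative algebraic closure as a matroid *)

Section AlgebraicClosure.
Variables (F L : fieldType) (iota : {rmorphism F -> L}).
Implicit Types (S T : seq L) (u v x y : L) (p q : {poly L}).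

(** The subring of [L] generated by the image of [F] and the members of [S]. *)
Inductive gen S : L -> Prop :=
| gen_const c : gen S (iota c)
| gen_elem x : x \in S -> gen S x
| gen_sub x y : gen S x -> gen S y -> gen S (x - y)
| gen_mul x y : gen S x -> gen S y -> gen S (x * y).

(** [cl S u]: [u] is algebraic over the field generated by [F] and [S].
    Denominators being cleared, the coefficients are taken in the subring. *)
Definition cl S u :=
  exists p, [/\ p != 0, forall i, gen S p`_i & root p u].

Lemma gen0 S : gen S 0.
Proof. by rewrite -(rmorph0 iota); apply: gen_const. Qed.

Lemma gen1 S : gen S 1.
Proof. by rewrite -(rmorph1 iota); apply: gen_const. Qed.

Lemma gen_opp S x : gen S x -> gen S (- x).
Proof. by move=> Sx; rewrite -sub0r; apply: gen_sub => //; apply: gen0. Qed.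

Lemma gen_add S x y : gen S x -> gen S y -> gen S (x + y).
Proof. by move=> Sx /gen_opp Sy; rewrite -[y]opprK; apply: gen_sub. Qed.

Lemma gen_exp S x n : gen S x -> gen S (x ^+ n).
Proof.
move=> Sx; elim: n => [|n IHn]; first by rewrite expr0; apply: gen1.
by rewrite exprS; apply: gen_mul.
Qed.

Lemma gen_sum S (I : Type) (r : seq I) (P : pred I) (f : I -> L) :
  (forall i, gen S (f i)) -> gen S (\sum_(i <- r | P i) f i).
Proof.
by move=> Sf; apply: big_ind => //; [apply: gen0 | apply: gen_add].
Qed.

Lemma gen_monotone S T x : {subset S <= T} -> gen S x -> gen T x.
Proof.
move=> sST; elim=> [c|y /sST|y z _ Ty _ Tz|y z _ Ty _ Tz].
- exact: gen_const.
- exact: gen_elem.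
- exact: gen_sub.
- exact: gen_mul.
Qed.

(** The fraction field of [gen S] inside [L], as a boolean predicate and then
    as a field type, so that the theory of integral elements applies to it. *)
Definition genq S : {pred L} :=
  fun y => `[< exists a b, [/\ gen S a, gen S b, b != 0 & y = a / b] >].

Lemma genqP S y :
  reflect (exists a b, [/\ gen S a, gen S b, b != 0 & y = a / b])
          (y \in genq S).
Proof. exact: asboolP. Qed.

Lemma genq_gen S y : gen S y -> y \in genq S.
Proof.
move=> Sy; apply/genqP; exists y, 1; rewrite oner_neq0 divr1.
by split=> //; apply: gen1.
Qed.

Lemma genq_divring_closed S : divring_closed (genq S).
Proof.
split=> [|x y|x y]; first exact/genq_gen/gen1.
  move=> /genqP[a [b [Sa Sb b0 ->]]] /genqP[c [d [Sc Sd d0 ->]]].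
  apply/genqP; exists (a * d - c * b), (b * d).
  split; [|exact: gen_mul|by rewrite mulf_neq0|].
    by apply: gen_sub; apply: gen_mul.
  by rewrite -mulNr addf_div // mulNr.
move=> /genqP[a [b [Sa Sb b0 ->]]] /genqP[c [d [Sc Sd d0 ->]]].
have [->|c0] := eqVneq c 0.
  by rewrite mul0r invr0 mulr0; apply/genq_gen/gen0.
apply/genqP; exists (a * d), (b * c); split; try exact: gen_mul.
  by rewrite mulf_neq0.
by rewrite invf_div mulf_div.
Qed.

HB.instance Definition _ S :=
  GRing.isDivringClosed.Build L (genq S) (genq_divring_closed S).

Record subfield_of S := SubfieldOf { sf_val : L; _ : sf_val \in genq S }.

HB.instance Definition _ S := [isSub for @sf_val S].
HB.instance Definition _ S := [Choice of subfield_of S by <:].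
HB.instance Definition _ S :=
  [SubChoice_isSubComUnitRing of subfield_of S by <:].
HB.instance Definition _ S :=
  [SubComUnitRing_isSubIntegralDomain of subfield_of S by <:].
HB.instance Definition _ S :=
  [SubIntegralDomain_isSubField of subfield_of S by <:].

Lemma gen_common_denominator S n (y : nat -> L) :
    (forall i, y i \in genq S) ->
  exists c, [/\ gen S c, c != 0 & forall i, (i < n)%N -> gen S (c * y i)].
Proof.
move=> Sy; elim: n => [|n [c [Sc c0 Hc]]].
  by exists 1; rewrite oner_neq0; split=> //; apply: gen1.
have /genqP[a [b [Sa Sb b0 Ey]]] := Sy n.
exists (c * b); split; [exact: gen_mul|exact: mulf_neq0|].
move=> i; rewrite ltnS leq_eqVlt => /orP[/eqP->|/Hc ci].
  by rewrite Ey -mulrA [b * _]mulrC divfK //; apply: gen_mul.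
by rewrite mulrAC; apply: gen_mul.
Qed.

Lemma cl_algebraicOver S u :
  cl S u <-> algebraicOver (val : subfield_of S -> L) u.
Proof.
split=> [[p [p0 Sp pu]] | [p p0 pu]].
  pose q : {poly subfield_of S} := \poly_(i < size p) insubd 0 p`_i.
  have Eq : map_poly (val : subfield_of S -> L) q = p.
    apply/polyP => i; rewrite coef_map /= coef_poly.
    case: ltnP => [_|/(nth_default 0)->]; last first.
      exact: (rmorph0 (val : {rmorphism subfield_of S -> L})).
    by rewrite /= insubdK //; apply: genq_gen.
  exists q; last by rewrite Eq.
  by rewrite -(map_poly_eq0 (val : {rmorphism subfield_of S -> L})) Eq.
set q := map_poly _ p in pu.
have q0 : q != 0 by rewrite map_poly_eq0.
have Sq i : q`_i \in genq S by rewrite coef_map; apply: valP.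
have [c [Sc c0 Hc]] := gen_common_denominator (size q) Sq.
exists (c *: q); split; first by rewrite scaler_eq0 negb_or c0.
  move=> i; rewrite coefZ; have [/Hc//|/(nth_default 0)->] := ltnP i (size q).
  by rewrite mulr0; apply: gen0.
by rewrite rootZ.
Qed.

Lemma cl_integralOver S u :
  cl S u <-> integralOver (val : subfield_of S -> L) u.
Proof.
by split=> [/cl_algebraicOver/integral_algebraic
           |/integral_algebraic/cl_algebraicOver].
Qed.

Lemma cl_sub S u v : cl S u -> cl S v -> cl S (u - v).
Proof.
by rewrite !cl_integralOver; apply: integral_sub.
Qed.

Lemma cl_mul S u v : cl S u -> cl S v -> cl S (u * v).
Proof. by rewrite !cl_integralOver; apply: integral_mul. Qed.

Lemma cl_gen S u : gen S u -> cl S u.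
Proof.
move=> Su; exists ('X - u%:P); split; rewrite ?polyXsubC_eq0 ?root_XsubC //.
move=> i; rewrite coefB coefX coefC.
by apply: gen_sub; case: eqP => // _; [apply: gen1|apply: gen0|apply: gen0].
Qed.

Lemma cl_elem S u : u \in S -> cl S u.
Proof. by move=> Su; apply/cl_gen/gen_elem. Qed.

Lemma cl0 S : cl S 0.
Proof. exact/cl_gen/gen0. Qed.

Lemma cl1 S : cl S 1.
Proof. exact/cl_gen/gen1. Qed.

Lemma cl_add S u v : cl S u -> cl S v -> cl S (u + v).
Proof.
by move=> Su Sv; rewrite -[v]opprK -[- v]sub0r; do ![apply: cl_sub]; rewrite //;
  apply: cl0.
Qed.

Lemma cl_subring S T u : (forall x, x \in T -> cl S x) -> gen T u -> cl S u.
Proof.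
move=> clT; elim=> [c|x /clT|x y _ clx _ cly|x y _ clx _ cly] //.
- exact/cl_gen/gen_const.
- exact: cl_sub.
- exact: cl_mul.
Qed.

Lemma cl_monotone S T u : {subset S <= T} -> cl S u -> cl T u.
Proof.
move=> sST [p [p0 Sp pu]]; exists p; split=> // i.
exact: gen_monotone (Sp i).
Qed.

(** An element which is algebraic over algebraic elements is algebraic. *)
Lemma cl_root S p u : p != 0 -> (forall i, cl S p`_i) -> root p u -> cl S u.
Proof.
move=> p0 Sp pu; apply/cl_integralOver; apply: integral_root p0 pu _.
by apply/integral_poly => i; apply/cl_integralOver.
Qed.

Lemma cl_trans S T u : (forall x, x \in T -> cl S x) -> cl T u -> cl S u.
Proof.
move=> clT [p [p0 Tp pu]]; apply: cl_root p0 _ pu => i.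
exact: cl_subring (Tp i).
Qed.

Lemma gen_cons S v y :
  gen (v :: S) y -> exists p, (forall i, gen S p`_i) /\ y = p.[v].
Proof.
elim=> {y} [c|x|x y _ [p [Sp ->]] _ [q [Sq ->]]
  |x y _ [p [Sp ->]] _ [q [Sq ->]]].
- exists (iota c)%:P; rewrite hornerC; split=> // i; rewrite coefC.
  by case: eqP => _; [apply: gen_const|apply: gen0].
- rewrite inE => /orP[/eqP->|Sx].
    exists 'X; rewrite hornerX; split=> // i; rewrite coefX.
    by case: eqP => _; [apply: gen1|apply: gen0].
  exists x%:P; rewrite hornerC; split=> // i; rewrite coefC.
  by case: eqP => _; [apply: gen_elem|apply: gen0].
- exists (p - q); rewrite hornerD hornerN; split=> // i.
  by rewrite coefB; apply: gen_sub.
- exists (p * q); rewrite hornerM; split=> // i.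
  by rewrite coefM; apply: gen_sum => k; apply: gen_mul.
Qed.

(** A polynomial relation between [u] and [v] with coefficients over [S] is
    read as a polynomial in [v] with coefficients over [u :: S]. It is not
    identically zero, because [u] is transcendental over [S]. *)
Lemma cl_exchange S u v : cl (v :: S) u -> ~ cl S u -> cl (u :: S) v.
Proof.
move=> [p [p0 Sp pu]] nSu.
have [P HP] := choice (fun i => gen_cons (Sp i)).
pose r j := \poly_(i < size p) (P i)`_j.
have rE j : r j = \sum_(i < size p) (P i)`_j *: 'X^i by rewrite /r poly_def.
(* W is the bivariate polynomial \sum_i P_i(Y) X^i evaluated at X = u. *)
pose W := \sum_(i < size p) P i * (u ^+ i)%:P.
have Wj j : W`_j = (r j).[u].
  rewrite coef_sum rE horner_sum; apply: eq_bigr => i _.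
  by rewrite coefMC hornerZ hornerXn.
have [W0|W0] := eqVneq W 0; last first.
  exists W; split=> // [i|].
    rewrite coef_sum; apply: gen_sum => k; rewrite coefMC; apply: gen_mul.
      apply: gen_monotone (proj1 (HP k) i) => x Sx.
      by rewrite inE Sx orbT.
    by apply/gen_exp/gen_elem; rewrite mem_head.
  apply/eqP; transitivity p.[u]; last exact/eqP.
  rewrite horner_sum horner_coef; apply: eq_bigr => i _.
  rewrite hornerM hornerC; congr (_ * _).
  by have [_ ->] := HP i.
case: nSu; have [j rj0] : exists j, r j != 0.
  apply: contrapT => /forallNP r0; case/eqP: p0; apply/polyP => i.
  rewrite coef0; have [ip|/(nth_default 0)//] := ltnP i (size p).
  have [_ ->] := HP i; suff -> : P i = 0 by rewrite horner0.
  apply/polyP => j; rewrite coef0; have /negP/negPn/eqP rj := r0 j.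
  have := coef_poly (size p) (fun i => (P i)`_j) i.
  by rewrite -/(r j) rj coef0 ip.
exists (r j); split=> // [i|]; last by rewrite /root -Wj W0 coef0.
by rewrite coef_poly; case: ifP => _; [case: (HP i)|apply: gen0].
Qed.

(** Algebraic independence of a list: no member is algebraic over the members
    that come after it. *)
Fixpoint indep S : Prop :=
  if S is x :: T then ~ cl T x /\ indep T else True.

Lemma indep_insert S T x : ~ cl (S ++ T) x -> indep (S ++ T) ->
  indep (S ++ x :: T).
Proof.
elim: S => [|y S IH] //= nx [ny iST]; split; last first.
  apply: IH iST => clx; apply: nx; apply: cl_monotone clx => z.
  by rewrite inE orbC => ->.
move=> cly; apply: nx; apply: cl_exchange ny; apply: cl_monotone cly => z.
by rewrite !inE !mem_cat inE orbCA.
Qed.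

Lemma indep_move S T U x :
  indep (S ++ x :: T ++ U) -> indep ((S ++ T) ++ x :: U).
Proof.
elim: S => [[nx iTU]|y S IH] /=; first exact: indep_insert.
move=> [ny /IH iSTU]; split=> // cly; apply: ny; apply: cl_monotone cly => z.
rewrite !(mem_cat, inE) -!orbA; case: (z \in S) => //=.
by rewrite orbCA.
Qed.

(** Steinitz exchange, relatively to [T]: the members of [S] are traded one by
    one for members of [U], which move over to [T]. *)
Lemma steinitz_rel S U T : indep (U ++ T) ->
  (forall x, x \in U -> cl (S ++ T) x) -> (size U <= size S)%N.
Proof.
elim: S U T => [|y S IH] U T iUT clU /=.
  case: U iUT clU => // x U [nx _] clU; case: nx.
  apply: cl_monotone (clU x (mem_head _ _)) => z /= Tz.
  by rewrite mem_cat Tz orbT.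
have [clU'|/existsNP[x /not_implyP[Ux nx]]] :=
  pselect (forall x, x \in U -> cl (S ++ T) x).
  exact: leqW (IH _ _ iUT clU').
have [U1 [U2 EU]] : exists U1 U2, U = U1 ++ x :: U2.
  by case: (splitPr Ux) => U1 U2; exists U1, U2.
subst U; rewrite size_cat /= addnS ltnS -size_cat.
move: iUT; rewrite -catA /= => /indep_move iUT; apply: IH (iUT) _ => z zU.
have cly : cl (x :: S ++ T) y by apply: cl_exchange nx; apply: clU.
apply: (@cl_trans _ (y :: S ++ T)); last first.
  by apply: clU; move: zU; rewrite !mem_cat inE => /orP[]->; rewrite ?orbT.
move=> w; rewrite inE => /orP[/eqP->|ST].
  by apply: cl_monotone cly => a; rewrite !(mem_cat, inE) orbCA.
by apply: cl_elem; move: ST; rewrite !(mem_cat, inE) => /orP[]->; rewrite ?orbT.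
Qed.

Lemma steinitz S U : indep U -> (forall x, x \in U -> cl S x) ->
  (size U <= size S)%N.
Proof.
move=> iU clU; apply: (@steinitz_rel _ _ [::]); first by rewrite cats0.
by rewrite cats0.
Qed.

(** [B] is a transcendence basis of the field generated by [S]. *)
Definition tbasis S B :=
  [/\ indep B, {subset B <= S} & forall x, x \in S -> cl B x].

Lemma tbasis_exists S : exists B, tbasis S B.
Proof.
elim: S => [|x S [B [iB sBS clB]]]; first by exists [::].
have [clx|nx] := pselect (cl B x).
  exists B; split=> // z; last by rewrite inE => /orP[/eqP->|/clB].
  by move=> /sBS Sz; rewrite inE Sz orbT.
exists (x :: B); split=> // [z|z]; rewrite inE.
  by rewrite inE => /orP[->|/sBS->] //; rewrite orbT.
case/orP => [/eqP->|/clB]; first by apply: cl_elem; rewrite mem_head.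
by apply: cl_monotone => w; rewrite inE orbC => ->.
Qed.

Lemma tbasis_cl S B x : tbasis S B -> cl S x -> cl B x.
Proof. by case=> _ _ clB; apply: cl_trans. Qed.

(** [S] consists of coefficients of [p] and [q], all of them up to constants. *)
Definition coef_gens S p q :=
  (forall x, x \in S -> (exists k, x = p`_k) \/ (exists k, x = q`_k)) /\
  (forall k, gen S p`_k /\ gen S q`_k).

Lemma cl_coefM S p q : (forall k, cl S p`_k) -> (forall k, cl S q`_k) ->
  forall k, cl S (p * q)`_k.
Proof.
move=> clp clq k; rewrite coefM; apply: big_ind; first exact: cl0.
  exact: cl_add.
by move=> l _; apply: cl_mul.
Qed.

Lemma cl_coef_XsubC S x : cl S x -> forall k, cl S ('X - x%:P)`_k.
Proof.
move=> clx k; rewrite coefB coefX coefC; apply: cl_sub.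
  by case: eqP => _; [apply: cl1|apply: cl0].
by case: eqP => _ //; apply: cl0.
Qed.

Lemma cl_coef_prod S (D : seq L) : (forall x, x \in D -> cl S x) ->
  forall k, cl S (\prod_(x <- D) ('X - x%:P))`_k.
Proof.
elim: D => [|x D IH] clD.
  by move=> k; rewrite big_nil coef1; case: eqP => _; [apply: cl1|apply: cl0].
rewrite big_cons; apply: cl_coefM.
  by apply/cl_coef_XsubC/clD; rewrite mem_head.
by apply: IH => y Dy; apply: clD; rewrite inE Dy orbT.
Qed.

Lemma cl_coef_div_XsubC S p x : cl S x ->
  (forall k, cl S (p * ('X - x%:P))`_k) -> forall k, cl S p`_k.
Proof.
move=> clx clpx.
suff clp m k : (size p <= k + m)%N -> cl S p`_k.
  by move=> k; apply: (clp (size p)); rewrite leq_addl.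
elim: m k => [|m IH] k.
  by rewrite addn0 => /(nth_default 0)->; apply: cl0.
rewrite addnS -addSn => /IH clk1.
have -> : p`_k = (p * ('X - x%:P))`_k.+1 + p`_k.+1 * x.
  by rewrite mulrBr coefB coefMX coefMC subrK.
by apply: cl_add => //; apply: cl_mul.
Qed.

Lemma cl_coef_div_prod S p (D : seq L) : (forall x, x \in D -> cl S x) ->
  (forall k, cl S (p * \prod_(x <- D) ('X - x%:P))`_k) -> forall k, cl S p`_k.
Proof.
elim: D p => [|x D IH] p clD; first by rewrite big_nil mulr1.
rewrite big_cons mulrA => /IH clpx; apply: (@cl_coef_div_XsubC _ _ x).
  by apply: clD; rewrite mem_head.
by apply: clpx => y Dy; apply: clD; rewrite inE Dy orbT.
Qed.

(** Multiplying [p] by linear factors with independent roots raises the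
    transcendence degree of the coefficients by the number of factors: the
    roots are algebraic over the coefficients of the product, and so are the
    coefficients of the quotient [p]. *)
Lemma tbasis_mul_linear S S' B B' (D : seq L) p q :
    p != 0 -> coef_gens S p q ->
    coef_gens S' (p * \prod_(x <- D) ('X - x%:P)) q ->
    tbasis S B -> indep (D ++ B) -> tbasis S' B' ->
  size B' = (size D + size B)%N.
Proof.
move=> p0 [Spq genS] [S'pq genS'] tB iDB tB'; apply/eqP; rewrite eqn_leq.
have [iB sBS _] := tB; have [iB' sBS' _] := tB'; rewrite -size_cat.
apply/andP; split; apply: steinitz => // x.
  have clB y : cl B y -> cl (D ++ B) y.
    by apply: cl_monotone => z; rewrite mem_cat orbC => ->.
  have clS k : cl (D ++ B) p`_k /\ cl (D ++ B) q`_k.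
    by case: (genS k) => gp gq; split; apply/clB/(tbasis_cl tB)/cl_gen.
  case/sBS'/S'pq => -[k ->]; last by case: (clS k).
  apply: cl_coefM => [l|]; first by case: (clS l).
  by apply: cl_coef_prod => y Dy; apply: cl_elem; rewrite mem_cat Dy.
move=> DBx; apply: (tbasis_cl tB').
have clD y : y \in D -> cl S' y.
  move=> Dy; apply: (@cl_root _ (p * \prod_(x <- D) ('X - x%:P))).
  - by rewrite mulf_neq0 // monic_neq0 // monic_prod_XsubC.
  - by move=> k; apply: cl_gen; case: (genS' k).
  by rewrite rootM root_prod_XsubC Dy orbT.
move: DBx; rewrite mem_cat => /orP[/clD//|/sBS/Spq[[k ->]|[k ->]]].
  by apply: (cl_coef_div_prod clD) => l; apply: cl_gen; case: (genS' l).
by apply: cl_gen; case: (genS' k).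
Qed.

End AlgebraicClosure.

(** * Algebraic independence and multivariate polynomials *)

Lemma mpoly_rmorph_ext (n : nat) (A : comNzRingType) (B : nzRingType)
    (f g : {rmorphism {mpoly A[n]} -> B}) :
  (forall c, f c%:MP = g c%:MP) -> (forall i, f 'X_i = g 'X_i) -> f =1 g.
Proof.
move=> fgC fgX p; rewrite [p]mpolyE !rmorph_sum; apply: eq_bigr => m _.
rewrite -mul_mpolyC !rmorphM fgC mpolyXE_id !rmorph_prod; congr (_ * _).
by apply: eq_bigr => i _; rewrite !rmorphXn fgX.
Qed.

Section FirstVariable.
Variables (A : comNzRingType) (n : nat).

(** The image of a variable under [uni]: the first one becomes the
    indeterminate, and the others are renumbered. *)
Definition uni_var (i : 'I_n.+1) : {poly {mpoly A[n]}} :=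
  if unlift ord0 i is Some j then ('X_j)%:P else 'X.

(** The isomorphism with the polynomials in the first variable. *)
Definition uni : {mpoly A[n.+1]} -> {poly {mpoly A[n]}} :=
  mmap (polyC \o @mpolyC n A) uni_var.

HB.instance Definition _ := GRing.RMorphism.copy uni uni.

(** The renumbering of the variables that makes room for a first one. *)
Definition mlift : {mpoly A[n]} -> {mpoly A[n.+1]} :=
  mmap (@mpolyC n.+1 A) (fun j => 'X_(lift ord0 j)).

HB.instance Definition _ := GRing.RMorphism.copy mlift mlift.

(** The inverse of [uni]. *)
Definition multi : {poly {mpoly A[n]}} -> {mpoly A[n.+1]} :=
  horner_eval 'X_ord0 \o map_poly mlift.

HB.instance Definition _ := GRing.RMorphism.copy multi multi.

Lemma uniC c : uni c%:MP = (c%:MP)%:P.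
Proof. by rewrite /uni mmapC. Qed.

Lemma uniX i : uni 'X_i = uni_var i.
Proof. by rewrite /uni mmapX mmap1U. Qed.

Lemma uni_var0 : uni_var ord0 = 'X.
Proof. by rewrite /uni_var unlift_none. Qed.

Lemma uni_var_lift j : uni_var (lift ord0 j) = ('X_j)%:P.
Proof. by rewrite /uni_var liftK. Qed.

Lemma mliftC c : mlift c%:MP = c%:MP.
Proof. by rewrite /mlift mmapC. Qed.

Lemma mliftX i : mlift 'X_i = 'X_(lift ord0 i).
Proof. by rewrite /mlift mmapX mmap1U. Qed.

Lemma uniK : cancel uni multi.
Proof.
apply: (@mpoly_rmorph_ext _ _ _ (multi \o uni) idfun) => [c|i] /=.
  by rewrite uniC /multi /= map_polyC /horner_eval /= hornerC mliftC.
rewrite uniX /multi /=; case: (unliftP ord0 i) => [j ->|->].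
  by rewrite uni_var_lift map_polyC /horner_eval /= hornerC mliftX.
by rewrite uni_var0 map_polyX /horner_eval hornerX.
Qed.

Lemma uni_lift p : uni (mlift p) = p%:P.
Proof.
apply: (@mpoly_rmorph_ext _ _ _ (uni \o mlift) (@polyC _)) => [c|i] /=.
  by rewrite mliftC uniC.
by rewrite mliftX uniX uni_var_lift.
Qed.

Lemma multiK : cancel multi uni.
Proof.
move=> p; rewrite /multi /= /horner_eval horner_coef size_map_inj_poly //.
- rewrite rmorph_sum -[RHS]coefK poly_def; apply: eq_bigr => i _ /=.
  by rewrite coef_map /= rmorphM rmorphXn /= uniX uni_var0 uni_lift mul_polyC.
- by apply: (can_inj (g := fun p => (uni p)`_0)) => q; rewrite uni_lift coefC.
by rewrite rmorph0.
Qed.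

Lemma mmap_uni (B : comNzRingType) (f : {rmorphism A -> B}) (x : 'I_n.+1 -> B)
    (P : {mpoly A[n.+1]}) :
  mmap f x P = (map_poly (mmap f (fun j => x (lift ord0 j))) (uni P)).[x ord0].
Proof.
apply: (@mpoly_rmorph_ext _ _ _ (mmap f x)
  (horner_eval (x ord0) \o map_poly (mmap f (fun j => x (lift ord0 j))) \o uni))
  => [c|i] /=.
  by rewrite uniC mmapC map_polyC /horner_eval /= hornerC mmapC.
rewrite uniX mmapX mmap1U; case: (unliftP ord0 i) => [j ->|->].
  by rewrite uni_var_lift map_polyC /horner_eval /= hornerC mmapX mmap1U.
by rewrite uni_var0 map_polyX /horner_eval hornerX.
Qed.

End FirstVariable.

Lemma poly_vanish (R : numFieldType) (p : {poly R}) :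
  (forall z, p.[z] = 0) -> p = 0.
Proof.
move=> pz; apply/eqP; apply: contraT => p0.
have := @max_poly_roots _ p [seq i%:R | i <- iota 0 (size p)] p0.
rewrite size_map size_iota ltnn => -> //.
  by apply/allP => z _; rewrite /root pz.
by rewrite map_inj_uniq ?iota_uniq // => i j /eqP; rewrite eqr_nat => /eqP.
Qed.

Lemma mpoly_vanish (R : numFieldType) (n : nat) (P : {mpoly R[n]}) :
  (forall a, P.@[a] = 0) -> P = 0.
Proof.
elim: n P => [|n IHn] P Pa.
  have := Pa (fun _ => 0); rewrite (nvar0_mpolyC P) mevalC => ->.
  exact: mpolyC0.
suff /(congr1 (@multi R n)) : uni P = 0 by rewrite uniK rmorph0.
apply/polyP => i; rewrite coef0; apply: IHn => a.
have pz : map_poly (meval a) (uni P) = 0.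
  apply: poly_vanish => z.
  pose b i := if unlift ord0 i is Some j then a j else z.
  have := Pa b; rewrite /meval mmap_uni.
  have -> : b ord0 = z by rewrite /b unlift_none.
  congr (_.[_] = _); apply: eq_map_poly => q; apply: meval_eq => j.
  by rewrite /b liftK.
by have := coef_map (meval a) (uni P) i; rewrite pz coef0 /= => <-.
Qed.

Section IndependentFamilies.
Variables (F L : fieldType) (iota : {rmorphism F -> L}).

Lemma gen_mmap (n : nat) (x : 'I_n -> L) (P : {mpoly F[n]}) :
  gen iota [seq x i | i <- enum 'I_n] (mmap iota x P).
Proof.
apply: gen_sum => m; apply: gen_mul; first exact: gen_const.
apply: (big_ind (gen iota _)); [exact: gen1|by move=> *; apply: gen_mul|].
move=> i _; apply/gen_exp/gen_elem/map_f; exact: mem_enum.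
Qed.

Lemma gen_mmapP (n : nat) (x : 'I_n -> L) y :
  gen iota [seq x i | i <- enum 'I_n] y -> exists P, y = mmap iota x P.
Proof.
elim=> {y} [c|y /mapP[i _ ->]|y z _ [P ->] _ [Q ->]|y z _ [P ->] _ [Q ->]].
- by exists c%:MP; rewrite mmapC.
- by exists 'X_i; rewrite mmapX mmap1U.
- by exists (P - Q); rewrite rmorphB.
- by exists (P * Q); rewrite rmorphM.
Qed.

(** The list notion of independence is the absence of polynomial relations. *)
Lemma indep_mpolyP (n : nat) (x : 'I_n -> L) :
  indep iota [seq x i | i <- enum 'I_n] <->
  (forall P : {mpoly F[n]}, mmap iota x P = 0 -> P = 0).
Proof.
elim: n x => [|n IHn] x.
  have -> : enum 'I_0 = [::] by apply: size0nil; rewrite size_enum_ord.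
  split=> // _ P; rewrite (nvar0_mpolyC P) mmapC => /eqP.
  by rewrite fmorph_eq0 => /eqP ->; rewrite mpolyC0.
rewrite enum_ordSl /= -map_comp.
have {IHn} := IHn (fun j => x (lift ord0 j)).
set x' := fun j => x (lift ord0 j) => IHn.
split=> [[nx0 /IHn ix'] P | ix].
  rewrite mmap_uni -/x'; set p := map_poly _ _ => px0.
  have [p0|p0] := eqVneq p 0; last first.
    case: nx0; exists p; split=> // [i|]; last exact/eqP.
    by rewrite coef_map; apply: gen_mmap.
  suff /(congr1 (@multi F n)) : uni P = 0 by rewrite uniK rmorph0.
  apply/polyP => i; rewrite coef0; apply: ix'.
  by have := coef_map (mmap iota x') (uni P) i; rewrite -/p p0 coef0 => <-.
split; last first.
  apply/IHn => P Px'; have /ix : mmap iota x (mlift P) = 0.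
    by rewrite mmap_uni uni_lift map_polyC hornerC.
  by move/(congr1 (@uni F n)); rewrite uni_lift rmorph0 => /eqP;
    rewrite polyC_eq0 => /eqP.
move=> [p [p0 gp px0]].
have [P HP] := choice (fun i => gen_mmapP (gp i)).
pose Q := \poly_(i < size p) P i.
have EQ : map_poly (mmap iota x') Q = p.
  apply/polyP => i; rewrite coef_map coef_poly /=.
  by case: ltnP => [_|/(nth_default 0)->]; rewrite ?HP // rmorph0.
have : mmap iota x (multi Q) = 0 by rewrite mmap_uni multiK EQ; apply/eqP.
move/ix/(congr1 (@uni F n)); rewrite multiK rmorph0 => Q0.
by case/eqP: p0; rewrite -EQ Q0 rmorph0.
Qed.

End IndependentFamilies.

(** * Dimension of a parametrized set *)

Section ParametrizedSets.
Variable (R : realType).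

(** The set parametrized by the polynomials [X]. *)
Definition poly_image (m N : nat) (X : 'I_N -> {mpoly R[m]}) :
    ('I_N -> R) -> Prop :=
  fun x => exists a : 'I_m -> R, x = fun s => (X s).@[a].

(** The constants in the field of rational functions of the parameters. *)
Definition const_frac (m : nat) : R -> {fraction {mpoly R[m]}} :=
  @tofrac _ \o @mpolyC m R.

HB.instance Definition _ m :=
  GRing.RMorphism.copy (@const_frac m) (@const_frac m).

Lemma mmap_tofrac (m N : nat) (X : 'I_N -> {mpoly R[m]}) (P : {mpoly R[N]}) :
  mmap (@const_frac m) (fun s => tofrac (X s)) P =
  tofrac (mmap (@mpolyC m R) X P).
Proof.
apply: (@mpoly_rmorph_ext _ _ _ (mmap (@const_frac m) _)
  (@tofrac _ \o mmap (@mpolyC m R) X)) => [c|i] /=.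
  by rewrite !mmapC.
by rewrite !mmapX !mmap1U.
Qed.

Lemma meval_mmap (m N : nat) (X : 'I_N -> {mpoly R[m]}) (P : {mpoly R[N]}) a :
  (mmap (@mpolyC m R) X P).@[a] = P.@[fun s => (X s).@[a]].
Proof.
apply: (@mpoly_rmorph_ext _ _ _ (meval a \o mmap (@mpolyC m R) X)
  (meval (fun s => (X s).@[a]))) => [c|i] /=.
  by rewrite mmapC !mevalC.
by rewrite mmapX mmap1U mevalXU.
Qed.

(** Polynomial functions on a parametrized set are pulled back to the ring of
    the parameters. *)
Lemma alg_indep_on_image (m N d : nat) (X : 'I_N -> {mpoly R[m]})
    (f : 'I_d -> {mpoly R[N]}) :
  alg_indep_on (poly_image X) f <->
  indep (@const_frac m)
    [seq tofrac (mmap (@mpolyC m R) X (f i)) | i <- enum 'I_d].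
Proof.
have EP (P : {mpoly R[d]}) :
    mmap (@const_frac m) (fun i => tofrac (mmap (@mpolyC m R) X (f i))) P = 0 <->
    (forall x, poly_image X x -> P.@[fun i => (f i).@[x]] = 0).
  rewrite mmap_tofrac; split=> [/eqP|P0].
    rewrite tofrac_eq0 => /eqP P0 _ [a ->].
    have := congr1 (meval a) P0; rewrite meval_mmap meval0 => <-.
    by apply: meval_eq => i; rewrite meval_mmap.
  apply/eqP; rewrite tofrac_eq0; apply/eqP/mpoly_vanish => a.
  rewrite meval_mmap -(P0 (fun s => (X s).@[a])); last by exists a.
  by apply: meval_eq => i; rewrite meval_mmap.
split=> [aif|/(indep_mpolyP (@const_frac m))aif P P0].
  by apply/(indep_mpolyP (@const_frac m)) => P /EP; apply: aif.
by apply: aif; apply/EP.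
Qed.

(** The dimension of a parametrized set is the transcendence degree of the
    field generated by the coordinates of its parametrization. *)
Lemma has_dim_image (m N d : nat) (X : 'I_N -> {mpoly R[m]}) :
  has_dim (poly_image X) d <->
  exists2 B, tbasis (@const_frac m) [seq tofrac (X s) | s <- enum 'I_N] B
           & size B = d.
Proof.
set S := [seq tofrac _ | _ <- _].
have le_size e (f : 'I_e -> {mpoly R[N]}) B : tbasis (@const_frac m) S B ->
    alg_indep_on (poly_image X) f -> (e <= size B)%N.
  move=> tB /alg_indep_on_image/steinitz leB.
  rewrite -[e]size_enum_ord -(size_map (fun i =>
    tofrac (mmap (@mpolyC m R) X (f i)))); apply: leB => x /mapP[i _ ->].
  apply: tbasis_cl tB _; apply: cl_gen; rewrite -mmap_tofrac.
  exact: gen_mmap.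
have basisP B : tbasis (@const_frac m) S B ->
    exists f : 'I_(size B) -> {mpoly R[N]}, alg_indep_on (poly_image X) f.
  case=> iB sBS _.
  have /choice[f Hf] (i : 'I_(size B)) : exists s, nth 0 B i = tofrac (X s).
    by have /sBS/mapP[s _ ->] := mem_nth 0 (ltn_ord i); exists s.
  exists (fun i => 'X_(f i)); apply/alg_indep_on_image.
  suff <- : B = [seq tofrac (mmap (@mpolyC m R) X 'X_(f i))
                   | i <- enum 'I_(size B)] by [].
  apply: (@eq_from_nth _ 0) => [|i iB']; first by rewrite size_map size_enum_ord.
  rewrite (nth_map (Ordinal iB')) ?size_enum_ord // mmapX mmap1U -Hf.
  by rewrite nth_enum_ord.
split=> [[[f aif] maxd]|[B tB <-]].
  have [B tB] := tbasis_exists (@const_frac m) S; exists B => //.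
  apply/eqP; rewrite eqn_leq (le_size _ _ _ tB aif) andbT.
  by have [g aig] := basisP B tB; apply: maxd aig.
split; first exact: basisP.
by move=> e f; apply: le_size.
Qed.

(** Only the closure of the set matters: points where some fixed nonzero
    polynomial [C] vanishes may be disregarded. *)
Lemma has_dim_dense (m m' N d : nat) (X : 'I_N -> {mpoly R[m]})
    (Y : 'I_N -> {mpoly R[m']}) (C : {mpoly R[m']}) :
    C != 0 -> (forall x, poly_image X x -> poly_image Y x) ->
    (forall a, C.@[a] != 0 -> poly_image X (fun s => (Y s).@[a])) ->
  has_dim (poly_image X) d -> has_dim (poly_image Y) d.
Proof.
move=> C0 XY YX.
have vanish (Q : {mpoly R[N]}) : (forall x, poly_image X x -> Q.@[x] = 0) ->
    forall x, poly_image Y x -> Q.@[x] = 0.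
  move=> QX _ [a ->]; rewrite -meval_mmap.
  suff -> : mmap (@mpolyC m' R) Y Q = 0 by rewrite meval0.
  apply/eqP; suff : mmap (@mpolyC m' R) Y Q * C == 0.
    by rewrite mulf_eq0 (negPf C0) orbF.
  apply/eqP/mpoly_vanish => b; rewrite mevalM meval_mmap.
  have [->|Cb] := eqVneq C.@[b] 0; first by rewrite mulr0.
  by rewrite QX ?mul0r //; apply: YX.
have indepE e (f : 'I_e -> {mpoly R[N]}) :
    alg_indep_on (poly_image X) f <-> alg_indep_on (poly_image Y) f.
  split=> aif P P0; apply: aif => x; first by move/XY; apply: P0.
  move=> Yx; rewrite -meval_mmap; apply: vanish Yx => y Xy.
  by rewrite meval_mmap; apply: P0.
case=> [[f aif] maxd]; split; first by exists f; apply/indepE.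
by move=> e g /indepE; apply: maxd.
Qed.

(** The variable ['X_i] viewed as the indeterminate over the others. *)
Definition isolate_var (m : nat) (i : 'I_m) :
    {mpoly R[m]} -> {poly {fraction {mpoly R[m]}}} :=
  mmap (polyC \o @const_frac m)
       (fun l => if l == i then 'X else (tofrac 'X_l)%:P).

HB.instance Definition _ m i :=
  GRing.RMorphism.copy (@isolate_var m i) (@isolate_var m i).

(** A variable is transcendental over polynomials that do not involve it. *)
Lemma not_cl_var (m : nat) (i : 'I_m) (S : seq {fraction {mpoly R[m]}}) :
    (forall x, x \in S ->
       exists2 a, x = tofrac a & isolate_var i a = (tofrac a)%:P) ->
  ~ cl (@const_frac m) S (tofrac 'X_i).
Proof.
move=> Si [p [p0 Sp pi0]].
have /choice[a Ha] k : exists a, p`_k = tofrac a /\ isolate_var i a = (p`_k)%:P.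
  elim: (Sp k) => {k} [c|x /Si[a ->]|x y _ [a [-> Ea]] _ [b [-> Eb]]
      |x y _ [a [-> Ea]] _ [b [-> Eb]]].
  - by exists c%:MP; rewrite /isolate_var mmapC.
  - by exists a.
  - by exists (a - b); rewrite !rmorphB /= Ea Eb.
  - by exists (a * b); rewrite !rmorphM /= Ea Eb.
have : \sum_(k < size p) a k * 'X_i ^+ k = 0.
  apply/eqP; rewrite -tofrac_eq0 -(eqP pi0) rmorph_sum horner_coef; apply/eqP.
  by apply: eq_bigr => k _; rewrite rmorphM rmorphXn /=; case: (Ha k) => <-.
move/(congr1 (isolate_var i)); rewrite rmorph_sum rmorph0 => /eqP.
apply/negP; congr (_ != 0): p0; rewrite -[LHS]coefK poly_def.
apply: eq_bigr => k _; rewrite rmorphM rmorphXn /=; case: (Ha k) => _ ->.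
by rewrite /isolate_var mmapX mmap1U eqxx mul_polyC.
Qed.

End ParametrizedSets.

(** * Characteristic matrices and their cofactors *)

(** A column solving [P u = det P e_i] consists of cofactors of row [i]. *)
Lemma cofactor_solve (A : idomainType) (m : nat) (P : 'M[A]_m) (i : 'I_m)
    (u : 'I_m -> A) :
    \det P != 0 -> (forall s, \sum_t P s t * u t = \det P *+ (s == i)) ->
  forall t, u t = cofactor P i t.
Proof.
move=> P0 Pu t; apply: (mulfI P0).
have := mulmxA (\adj P) P (\col_s u s); rewrite mul_adj_mx mul_scalar_mx.
move/matrixP => /(_ t 0); rewrite !mxE => <-.
rewrite (bigD1 i) //= big1 ?addr0 => [|s si].
  rewrite !mxE mulrC; congr (_ * _).
  transitivity (\det P *+ (i == i)); last by rewrite eqxx.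
  by rewrite -Pu; apply: eq_bigr => s _; rewrite !mxE.
rewrite !mxE [X in _ * X](_ : _ = 0) ?mulr0 //.
transitivity (\det P *+ (s == i)); last by rewrite (negPf si).
by rewrite -Pu; apply: eq_bigr => s' _; rewrite !mxE.
Qed.

Lemma cofactor_sum (A : comNzRingType) (m : nat) (P : 'M[A]_m) i s :
  \sum_t P s t * cofactor P i t = \det P *+ (s == i).
Proof.
have /matrixP/(_ s i) := mul_mx_adj P; rewrite !mxE => <-.
by apply: eq_bigr => t _; rewrite !mxE.
Qed.

Lemma char_poly_neq0 (A : nzRingType) (m : nat) (B : 'M[A]_m) :
  char_poly B != 0.
Proof. exact/monic_neq0/char_poly_monic. Qed.

Lemma char_poly_mxE (A : nzRingType) (m : nat) (B : 'M[A]_m) s t :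
  char_poly_mx B s t = 'X *+ (s == t) - (B s t)%:P.
Proof. by rewrite !mxE. Qed.

Section DiagonalConjugation.
Variables (K : fieldType) (m : nat) (B : 'M[K]_m) (D : 'I_m -> K).
Hypothesis D0 : forall s, D s != 0.

(* The conjugate of B by the diagonal matrix with entries D. *)
Let B' : 'M[K]_m := \matrix_(s, t) (D s * B s t / D t).

Lemma char_poly_mx_conj s t :
  char_poly_mx B' s t = (D s)%:P * char_poly_mx B s t * (D t)^-1%:P.
Proof.
rewrite !char_poly_mxE mxE !polyCM mulrBr mulrBl; congr (_ - _).
case: eqP => [<-|_]; last by rewrite !mulr0n mulr0 mul0r.
by rewrite mulr1n mulrAC -polyCM divff // mul1r.
Qed.

Lemma char_poly_conj : char_poly B' = char_poly B.
Proof.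
pose dg (f : 'I_m -> K) : 'M[{poly K}]_m := diag_mx (\row_s (f s)%:P).
have -> : char_poly B' = \det (dg D *m char_poly_mx B *m dg (fun s => (D s)^-1)).
  congr (\det _); apply/matrixP => s t.
  by rewrite char_poly_mx_conj mul_mx_diag mul_diag_mx !mxE.
rewrite !det_mulmx mulrAC -det_mulmx.
rewrite [X in \det X](_ : _ = 1%:M) ?det1 ?mul1r //.
apply/matrixP => s t; rewrite mul_diag_mx !mxE.
case: eqP => [->|_]; last by rewrite !mulr0n mulr0.
by rewrite !mulr1n -polyCM divff.
Qed.

(** In general the cofactor is multiplied by [D j / D i]. *)
Lemma cofactor_conj i j : D i = D j ->
  cofactor (char_poly_mx B') i j = cofactor (char_poly_mx B) i j.
Proof.
move=> Dij.
rewrite -(@cofactor_solve _ _ (char_poly_mx B') i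
  (fun t => (D t / D i)%:P * cofactor (char_poly_mx B) i t)).
- by rewrite Dij divff // mul1r.
- exact: char_poly_neq0.
move=> s; rewrite -!/(char_poly _) char_poly_conj.
transitivity ((D s / D i)%:P *
    \sum_t char_poly_mx B s t * cofactor (char_poly_mx B) i t).
  rewrite mulr_sumr; apply: eq_bigr => t _.
  rewrite char_poly_mx_conj !polyCM mulrA.
  have -> : (D s)%:P * (D i)^-1%:P *
      (char_poly_mx B s t * cofactor (char_poly_mx B) i t) =
    (D s)%:P * char_poly_mx B s t * (D i)^-1%:P * cofactor (char_poly_mx B) i t.
    by rewrite mulrA [_ * _^-1%:P * _]mulrAC.
  congr (_ * _); rewrite -!mulrA; congr (_ * (_ * _)).
  by rewrite mulrA -polyCM mulVf // mul1r.
rewrite cofactor_sum; case: eqP => [->|_]; last by rewrite mulr0.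
by rewrite divff // mul1r.
Qed.

End DiagonalConjugation.

Lemma char_poly_mxsub_bij (A : comNzRingType) (m m' : nat) (g : 'I_m -> 'I_m')
    (B : 'M[A]_m') : bijective g -> char_poly (mxsub g g B) = char_poly B.
Proof.
move=> bg; have Em : m = m' by have := bij_eq_card bg; rewrite !card_ord.
subst m'; rewrite /char_poly.
have -> : char_poly_mx (mxsub g g B) =
  row_perm (perm (bij_inj bg)) (col_perm (perm (bij_inj bg)) (char_poly_mx B)).
  by apply/matrixP => s t; rewrite !mxE !permE (inj_eq (bij_inj bg)).
rewrite row_permE col_permE !det_mulmx !det_perm odd_permV.
by rewrite mulrCA -signr_addb addbb mulr1.
Qed.

Lemma char_poly_ublock (A : comNzRingType) (m n : nat) (B : 'M[A]_m)
    (C : 'M[A]_(m, n)) (D : 'M[A]_n) :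
  char_poly (block_mx B C 0 D) = char_poly B * char_poly D.
Proof.
rewrite /char_poly /char_poly_mx map_block_mx scalar_mx_block opp_block_mx.
by rewrite add_block_mx map_mx0 subr0 det_ublock.
Qed.

(** Restriction of a square matrix to the rows and columns indexed by [H]. *)
Definition restr_mx (A : Type) (n : nat) (H : {set 'I_n}) (B : 'M[A]_n) :
  'M[A]_#|H| := mxsub (@enum_val _ (mem H)) (@enum_val _ (mem H)) B.

(** [cofactor_solve] for a restricted matrix, the candidate [u] being given on
    all the indices and the sums running over [H]. *)
Lemma cofactor_restr_solve (A : idomainType) (n : nat) (H : {set 'I_n})
    (B : 'M[A]_n) (u : 'I_n -> {poly A}) (i : 'I_#|H|) :
    (forall s, s \in H ->
       \sum_(t in H) ('X *+ (s == t) - (B s t)%:P) * u t =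
       char_poly (restr_mx H B) *+ (s == enum_val i)) ->
  forall j, cofactor (char_poly_mx (restr_mx H B)) i j = u (enum_val j).
Proof.
move=> Bu j; symmetry; apply: (@cofactor_solve _ _ _ _ (fun t => u (enum_val t))).
  exact: char_poly_neq0.
move=> s; rewrite -(inj_eq enum_val_inj) -Bu ?enum_valP //.
rewrite [RHS]big_enum_val /=; apply: eq_bigr => t _.
by rewrite char_poly_mxE mxE (inj_eq enum_val_inj).
Qed.

Lemma cofactor_restr_sum (A : comNzRingType) (n : nat) (H : {set 'I_n})
    (B : 'M[A]_n) (i : 'I_#|H|) s : s \in H ->
  \sum_(t in H) ('X *+ (s == t) - (B s t)%:P) *
     cofactor (char_poly_mx (restr_mx H B)) i (enum_rank_in (enum_valP i) t) =
  char_poly (restr_mx H B) *+ (s == enum_val i).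
Proof.
move=> Hs; rewrite -(enum_rankK_in (enum_valP i) Hs) (inj_eq enum_val_inj).
rewrite -cofactor_sum big_enum_val /=; apply: eq_bigr => t _.
by rewrite char_poly_mxE mxE (inj_eq enum_val_inj) enum_valK_in.
Qed.

(** * Prepending a path to the input *)

Section Chain.
Variables (A : idomainType) (n k : nat) (B : 'M[A]_n.+1) (d : 'I_k.+1 -> A).
Variables (H : {set 'I_n.+1}) (H' : {set 'I_(n.+1 + k.+1)}).
Hypothesis H'l : forall v, (lshift k.+1 v \in H') = (v \in H).
Hypothesis H'r : forall s, rshift n.+1 s \in H'.

(** The matrix [B] extended by a path entering the vertex [0], with diagonal
    entries [d] and with all the new edge parameters equal to 1. *)
Definition chain_mx (A0 : nzRingType) (n0 k0 : nat) (B0 : 'M[A0]_n0.+1)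
    (d0 : 'I_k0.+1 -> A0) : 'M[A0]_(n0.+1 + k0.+1) :=
  block_mx B0 (\matrix_(i, s) ((i == ord0) && (s == ord0))%:R)
    0 (\matrix_(s, t) if s == t then d0 s else (t == s.+1 :> nat)%:R).

Let C := chain_mx B d.

Lemma char_poly_path :
  char_poly (\matrix_(s, t) if s == t then d s else (t == s.+1 :> nat)%:R) =
  \prod_s ('X - (d s)%:P).
Proof.
set T := \matrix_(s, t) _.
have <- : char_poly T^T = char_poly T.
  rewrite /char_poly -det_tr; congr (\det _).
  by apply/matrixP => s t; rewrite !mxE eq_sym.
rewrite char_poly_trig; last first.
  apply/is_trig_mxP => s t lt_st; rewrite !mxE -val_eqE /= gtn_eqF //.
  by rewrite ltn_eqF // (leq_trans lt_st).
by apply: eq_bigr => s _; rewrite !mxE eqxx.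
Qed.

Lemma chain_set_card : #|H'| = (#|H| + k.+1)%N.
Proof.
pose f := @lshift n.+1 k.+1; pose g := @rshift n.+1 k.+1.
have -> : H' = (f @: H) :|: (g @: setT).
  apply/setP => w; rewrite inE; case: (splitP w) => [v|s] Ew.
    have -> : w = f v by apply: val_inj.
    rewrite H'l mem_imset; last exact: lshift_inj.
    by rewrite [X in _ || X](_ : _ = false) ?orbF //; apply/negP =>
      /imsetP[s _ /eqP]; rewrite eq_lrshift.
  have -> : w = g s by apply: val_inj.
  by rewrite H'r [X in _ || X]imset_f ?orbT.
rewrite cardsU [X in (_ - #|pred_of_set X|)%N](_ : _ = set0); last first.
  apply/eqP; rewrite -subset0; apply/subsetP => w; rewrite inE.
  by case/andP => /imsetP[v _ ->] /imsetP[s _ /eqP]; rewrite eq_lrshift.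
rewrite cards0 subn0 !card_imset ?cardsT ?card_ord //.
  exact: rshift_inj.
exact: lshift_inj.
Qed.

Lemma char_poly_chain :
  char_poly (restr_mx H' C) =
  char_poly (restr_mx H B) * \prod_s ('X - (d s)%:P).
Proof.
(* g lists the members of H' in the order of the blocks of chain_mx. *)
pose r := enum_rank_in (H'r ord0).
pose g (x : 'I_(#|H| + k.+1)) := r (match split x with
  | inl a => lshift k.+1 (enum_val a) | inr s => rshift n.+1 s end).
have gE x : enum_val (g x) = match split x with
  | inl a => lshift k.+1 (enum_val a) | inr s => rshift n.+1 s end.
  by rewrite enum_rankK_in //; case: split => [a|s]; rewrite ?H'l ?enum_valP.
have bij_g : bijective g.
  apply: inj_card_bij; last by rewrite !card_ord chain_set_card.
  move=> x y /(congr1 enum_val); rewrite !gE.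
  case: (splitP x) => [a|s] Ex; case: (splitP y) => [b|t] Ey /eqP.
  - rewrite eq_lshift (inj_eq enum_val_inj) => /eqP ab.
    by apply: val_inj; rewrite /= Ex Ey ab.
  - by rewrite eq_lrshift.
  - by rewrite eq_rlshift.
  - by rewrite eq_rshift => /eqP st; apply: val_inj; rewrite /= Ex Ey st.
rewrite -(char_poly_mxsub_bij _ bij_g) -char_poly_path.
rewrite -(char_poly_ublock _
  (\matrix_(x, s) ((enum_val x == ord0) && (s == ord0))%:R)).
congr char_poly; apply/matrixP => x y.
transitivity (C (enum_val (g x)) (enum_val (g y))); first by rewrite !mxE.
rewrite !gE; case: (splitP x) => a Ex; case: (splitP y) => b Ey.
- have -> : x = lshift k.+1 a by apply: val_inj.
  have -> : y = lshift k.+1 b by apply: val_inj.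
  by rewrite !block_mxEul mxE.
- have -> : x = lshift k.+1 a by apply: val_inj.
  have -> : y = rshift #|H| b by apply: val_inj.
  by rewrite !block_mxEur !mxE.
- have -> : x = rshift #|H| a by apply: val_inj.
  have -> : y = lshift k.+1 b by apply: val_inj.
  by rewrite !block_mxEdl !mxE.
have -> : x = rshift #|H| a by apply: val_inj.
have -> : y = rshift #|H| b by apply: val_inj.
by rewrite !block_mxEdr !mxE.
Qed.

Lemma cofactor_chain (i j : 'I_#|H|) (i' j' : 'I_#|H'|) :
    enum_val i = ord0 -> enum_val i' = rshift n.+1 ord_max ->
    enum_val j' = lshift k.+1 (enum_val j) ->
  cofactor (char_poly_mx (restr_mx H' C)) i' j' =
  cofactor (char_poly_mx (restr_mx H B)) i j.
Proof.
move=> Ei Ei' Ej'; set p := char_poly (restr_mx H B).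
(* Back substitution along the path gives the solution u of the column
   equation of the characteristic matrix for the last vertex of the path. *)
pose u (w : 'I_(n.+1 + k.+1)) := match split w with
  | inl v => cofactor (char_poly_mx (restr_mx H B)) i
               (enum_rank_in (enum_valP i) v)
  | inr s => p * \prod_(t < k.+1 | (t < s)%N) ('X - (d t)%:P) end.
have ul v : u (lshift k.+1 v) = cofactor (char_poly_mx (restr_mx H B)) i
    (enum_rank_in (enum_valP i) v).
  by rewrite /u -[lshift _ _]/(unsplit (inl v)) unsplitK.
have ur s : u (rshift n.+1 s) = p * \prod_(t < k.+1 | (t < s)%N) ('X - (d t)%:P).
  by rewrite /u -[rshift _ _]/(unsplit (inr s)) unsplitK.
rewrite (@cofactor_restr_solve _ _ _ _ u) ?Ej' ?ul ?enum_valK_in //.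
move=> w wH'; rewrite Ei' char_poly_chain -/p big_mkcond big_split_ord /=.
under eq_bigr => v _ do rewrite H'l ul.
under [X in _ + X]eq_bigr => s _ do rewrite H'r ur.
rewrite -big_mkcond /=.
case: (splitP w) => [v|s] Ew.
  have {Ew}Ew : w = lshift k.+1 v by apply: val_inj.
  subst w; rewrite eq_lrshift mulr0n.
  under eq_bigr => v' _ do rewrite eq_lshift block_mxEul.
  rewrite cofactor_restr_sum -?H'l // Ei.
  rewrite (bigD1 ord0) //= [X in _ + (_ + X)]big1 => [|s s0]; last first.
    by rewrite eq_lrshift block_mxEur mxE (negPf s0) andbF mulr0n !subr0 mul0r.
  rewrite eq_lrshift block_mxEur mxE eqxx andbT mulr0n sub0r addr0.
  rewrite [X in p * X]big_pred0 // mulr1 -/p.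
  by case: eqP => _; rewrite ?mulr1n ?mulr0n ?oppr0 ?mul0r ?addr0 // mulN1r subrr.
have {Ew}Ew : w = rshift n.+1 s by apply: val_inj.
subst w; rewrite big1 ?add0r => [|v _]; last first.
  by rewrite eq_rlshift block_mxEdl mxE subr0 mul0r.
under eq_bigr => t _ do rewrite eq_rshift block_mxEdr mxE.
rewrite eq_rshift (bigD1 s) //= eqxx mulr1n.
have Es : ('X - (d s)%:P) * (p * \prod_(t < k.+1 | (t < s)%N) ('X - (d t)%:P)) =
    p * \prod_(t < k.+1 | (t < s.+1)%N) ('X - (d t)%:P).
  rewrite mulrCA; congr (_ * _); rewrite [RHS](bigD1 s) //=; congr (_ * _).
  by apply: eq_bigl => t; rewrite ltnS ltn_neqAle andbC -val_eqE.
rewrite {}Es.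
have [->|smax] := eqVneq s ord_max.
  rewrite [X in _ + X = _]big1 ?addr0 => [|t tmax]; last first.
    rewrite eq_sym (negPf tmax) mulr0n sub0r.
    by rewrite [_ == _ :> nat]ltn_eqF ?oppr0 ?mul0r.
  by rewrite mulr1n; congr (_ * _); apply: eq_bigl => t; rewrite ltn_ord.
have lt_s : (s.+1 < k.+1)%N.
  by rewrite ltnS ltn_neqAle -ltnS ltn_ord andbT.
rewrite [X in _ + X = _](bigD1 (Ordinal lt_s)) /=; last by rewrite -val_eqE /= gtn_eqF.
rewrite -val_eqE /= ltn_eqF // mulr0n eqxx sub0r mulN1r.
rewrite [X in _ + (_ + X)]big1 ?addr0 ?subrr // => t /andP[ts ts1].
rewrite eq_sym (negPf ts) mulr0n sub0r.
by rewrite -val_eqE in ts1; rewrite (negPf ts1) oppr0 mul0r.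
Qed.

End Chain.

(** * Compartmental matrices with a leak in every compartment *)

Lemma map_tnth_in_tuple (T U : Type) (s : seq T) (f : T -> U) :
  [seq f (tnth (in_tuple s) i) | i <- enum 'I_(size s)] = [seq f q | q <- s].
Proof. by rewrite (map_comp f) map_tnth_enum. Qed.

Lemma mem_edges (n : nat) (G : digraph n) u v : ((u, v) \in edges G) = G u v.
Proof. by rewrite inE. Qed.

Section FullLeak.
Variables (R : realType) (n : nat) (G : digraph n) (i j : 'I_n).
Let M := full_leak_model G i j.

Lemma compartmental_mx_supp u v : u != v -> ~~ G v u ->
  compartmental_mx R M u v = 0.
Proof.
move=> /negPf uv nG; rewrite -(mem_edges G) in nG.
by rewrite mxE uv /edge_param insubN.
Qed.

(** With all the leaks present, the compartmental matrix is the generic matrix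
    supported on the edges and the diagonal: any such matrix [B] arises, and
    [param_value B] is the choice of parameters that produces it. *)
Definition param_value (A : zmodType) (B : 'M[A]_n) (r : 'I_#|param M|) : A :=
  match enum_val r with
  | inl e => B (val e).2 (val e).1
  | inr l => - B (val l) (val l) - \sum_(k | G (val l) k) B k (val l)
  end.

Lemma compartmental_mx_onto (A : comNzRingType) (c : {rmorphism R -> A})
    (B : 'M[A]_n) :
    (forall u v, u != v -> ~~ G v u -> B u v = 0) ->
  map_mx (mmap c (param_value B)) (compartmental_mx R M) = B.
Proof.
move=> suppB; set f := mmap _ _.
have fE u v : G v u -> f (edge_param R M u v) = B u v.
  move=> Gvu; rewrite /edge_param; case: insubP => [e _ Ee|]; last first.
    by move=> /negP[]; rewrite -(mem_edges G) in Gvu.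
  by rewrite /f mmapX mmap1U /param_value enum_rankK Ee.
apply/matrixP => u v; rewrite !mxE; case: eqVneq => [<-|uv]; last first.
  have [|nG] := boolP (G v u); first exact: fE.
  rewrite suppB //; rewrite -(mem_edges G) in nG.
  by rewrite /edge_param insubN // /f rmorph0.
rewrite /f rmorphB rmorphN rmorph_sum /= -/f /leak_param.
case: insubP => [l _ El|]; last by rewrite in_setT.
rewrite [f _]mmapX mmap1U /param_value enum_rankK El opprB opprK.
rewrite [X in _ + _ - X](eq_bigr (fun k => B k u)) => [|k Guk]; last exact: fE.
by rewrite addrAC subrr add0r.
Qed.

Lemma reach_mxE (l : 'I_n) :
  reach_mx R M l = restr_mx (output_reachable M l) (compartmental_mx R M).
Proof. by []. Qed.

Lemma map_io_lhs (A : comNzRingType) (f : {rmorphism param_ring R M -> A})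
    (B : 'M[A]_n) :
    map_mx f (compartmental_mx R M) = B ->
  map_poly f (io_lhs R M j) = char_poly (restr_mx (output_reachable M j) B).
Proof. by move=> <-; rewrite /io_lhs map_char_poly reach_mxE map_mxsub. Qed.

Lemma map_io_rhs (A : comNzRingType) (f : {rmorphism param_ring R M -> A})
    (B : 'M[A]_n) :
    map_mx f (compartmental_mx R M) = B ->
  map_poly f (io_rhs R M j i) =
  cofactor (char_poly_mx (restr_mx (output_reachable M j) B))
           (reach_pos M j i) (reach_pos M j j).
Proof.
move=> <-; rewrite /io_rhs -cofactor_map_mx map_char_poly_mx.
by rewrite reach_mxE map_mxsub.
Qed.

Lemma coeffs_connect : connect G i j ->
  coeffs R M = [seq q <- (io_lhs R M j : seq _) ++ (io_rhs R M j i : seq _)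
                  | (q != 0) && (q != 1)].
Proof.
move=> Gij; rewrite /coeffs.
have -> : enum (has_io_equation M) = [:: j].
  rewrite -(enum1 j); apply: eq_enum => l; rewrite !inE /has_io_equation /=.
  rewrite [_ \in has_io_equation M]/(_ && _) inE.
  case: eqP => //= ->; apply/existsP; exists i; rewrite /= inE eqxx /=.
  exact: Gij.
rewrite /= cats0 /io_coeffs.
have -> : enum (inp M :&: output_reachable M j) = [:: i].
  rewrite -(enum1 i); apply: eq_enum => l; rewrite !inE /=.
  by case: eqP => // ->; apply: Gij.
by rewrite /= cats0.
Qed.

Lemma coeffs_not_connect : ~~ connect G i j -> coeffs R M = [::].
Proof.
move=> nGij; rewrite /coeffs.
suff -> : enum (has_io_equation M) = [::] by [].
rewrite -(enum0 'I_n); apply: eq_enum => l; rewrite [RHS]inE.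
apply/negP => /andP[]; rewrite inE => /eqP -> /existsP[l' /andP[]].
by rewrite inE => /eqP ->; apply/negP.
Qed.

Lemma mem_coeffs q : q \in coeffs R M ->
  (exists k, q = (io_lhs R M j)`_k) \/ (exists k, q = (io_rhs R M j i)`_k).
Proof.
have [Gij|nGij] := boolP (connect G i j); last by rewrite coeffs_not_connect.
rewrite coeffs_connect // mem_filter mem_cat => /andP[_].
by case/orP => /(nthP 0)[k _ <-]; [left|right]; exists k.
Qed.

(** The constants that are left out do not matter: the coefficient list
    generates the same ring as all the coefficients of both operators. *)
Lemma coeffs_gens (L : fieldType) (c : {rmorphism R -> L})
    (f : {rmorphism param_ring R M -> L}) :
    connect G i j ->
  coef_gens c [seq f q | q <- coeffs R M]
    (map_poly f (io_lhs R M j)) (map_poly f (io_rhs R M j i)).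
Proof.
move=> Gij; split=> [x /mapP[q /mem_coeffs[[k ->]|[k ->]] ->]|k].
- by left; exists k; rewrite coef_map.
- by right; exists k; rewrite coef_map.
have genq (p : {poly param_ring R M}) :
    {subset (p : seq _) <= (io_lhs R M j : seq _) ++ (io_rhs R M j i : seq _)} ->
    gen c [seq f q | q <- coeffs R M] (map_poly f p)`_k.
  move=> sp; rewrite coef_map /=.
  have [kp|/(nth_default 0)->] := ltnP k (size p); last first.
    by rewrite rmorph0; apply: gen0.
  have [->|p0] := eqVneq p`_k 0; first by rewrite rmorph0; apply: gen0.
  have [->|p1] := eqVneq p`_k 1; first by rewrite rmorph1; apply: gen1.
  apply/gen_elem/map_f; rewrite coeffs_connect // mem_filter p0 p1 /=.
  exact/sp/mem_nth.
by split; apply: genq => q; rewrite mem_cat => ->; rewrite ?orbT.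
Qed.

End FullLeak.

(** * The model with a path prepended *)

Section ChainModel.
Variables (R : realType) (n k : nat) (G : digraph n.+1) (j : 'I_n.+1).
Let M := full_leak_model G ord0 j.
Let G' := chain_graph k.+1 G.
Let M' := full_leak_model G' (rshift n.+1 (@ord_max k)) (lshift k.+1 j).

Lemma split_lshift (m l : nat) (v : 'I_m) : split (lshift l v) = inl v.
Proof. exact: (unsplitK (inl v)). Qed.

Lemma split_rshift (m l : nat) (s : 'I_l) : split (rshift m s) = inr s.
Proof. exact: (unsplitK (inr s)). Qed.

Lemma chain_arc_ll u v : G' (lshift k.+1 u) (lshift k.+1 v) = G u v.
Proof. by rewrite /G' /= /chain_arc !split_lshift. Qed.

Lemma chain_arc_lr u s : G' (lshift k.+1 u) (rshift n.+1 s) = false.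
Proof. by rewrite /G' /= /chain_arc split_lshift split_rshift. Qed.

Lemma chain_arc_rl s v :
  G' (rshift n.+1 s) (lshift k.+1 v) = (s == ord0) && (v == ord0).
Proof. by rewrite /G' /= /chain_arc split_lshift split_rshift. Qed.

Lemma chain_arc_rr s t : G' (rshift n.+1 s) (rshift n.+1 t) = (s == t.+1 :> nat).
Proof. by rewrite /G' /= /chain_arc !split_rshift. Qed.

Lemma connect_lshift u v :
  connect G' (lshift k.+1 u) (lshift k.+1 v) = connect G u v.
Proof.
apply/idP/idP.
  case/connectP => p; elim: p u => [|w p IH] u /=.
    by move=> _ /lshift_inj ->; apply: connect0.
  case/andP; case: (splitP w) => [w' Ew|s Ew].
    have -> : w = lshift k.+1 w' by apply: val_inj.
    rewrite [chain_arc _ _ _]chain_arc_ll => Guw pw Ev.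
    exact: connect_trans (connect1 Guw) (IH _ pw Ev).
  have -> : w = rshift n.+1 s by apply: val_inj.
  by rewrite [chain_arc _ _ _]chain_arc_lr.
case/connectP => p; elim: p u => [|w p IH] u /=.
  by move=> _ ->; apply: connect0.
case/andP => Guw pw Ev; apply: connect_trans (IH _ pw Ev).
by apply: connect1; rewrite chain_arc_ll.
Qed.

Lemma connect_rshift s : connect G' (rshift n.+1 s) (lshift k.+1 ord0).
Proof.
case: s => m; elim: m => [|m IH] lt_m.
  by apply: connect1; rewrite chain_arc_rl.
apply: connect_trans (IH (ltnW lt_m)); apply: connect1.
by rewrite chain_arc_rr.
Qed.

Lemma reach_lshift v :
  (lshift k.+1 v \in output_reachable M' (lshift k.+1 j)) =
  (v \in output_reachable M j).
Proof. by rewrite !inE; apply: connect_lshift. Qed.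

Lemma reach_rshift s : connect G ord0 j ->
  rshift n.+1 s \in output_reachable M' (lshift k.+1 j).
Proof.
move=> Gj; rewrite inE; apply: connect_trans (connect_rshift s) _.
by rewrite connect_lshift.
Qed.

Lemma card_chain_edges : #|edges G'| = (#|edges G| + k.+1)%N.
Proof.
pose f (e : 'I_n.+1 * 'I_n.+1) := (lshift k.+1 e.1, lshift k.+1 e.2).
pose g (s : 'I_k.+1) := (rshift n.+1 s,
  if val s is t.+1 then rshift n.+1 (inord t) else lshift k.+1 ord0).
have Eg s : G' (g s).1 (g s).2.
  case: s => [[|m] lt_m]; rewrite /g /=.
    by rewrite [chain_arc _ _ _]chain_arc_rl.
  by rewrite [chain_arc _ _ _]chain_arc_rr inordK // ltnW.
have -> : edges G' = (f @: edges G) :|: (g @: setT).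
  apply/setP => -[u v]; rewrite in_setU;
  apply/idP/idP => [|/orP[/imsetP[e]|/imsetP[s _]]].
  - rewrite mem_edges; case: (splitP u) => [a|s] Eu; case: (splitP v) => [b|t] Ev.
    + have -> : u = lshift k.+1 a by apply: val_inj.
      have -> : v = lshift k.+1 b by apply: val_inj.
      rewrite chain_arc_ll => Gab; apply/orP; left.
      by apply/imsetP; exists (a, b); rewrite ?inE.
    + have -> : u = lshift k.+1 a by apply: val_inj.
      have -> : v = rshift n.+1 t by apply: val_inj.
      by rewrite chain_arc_lr.
    + have -> : u = rshift n.+1 s by apply: val_inj.
      have -> : v = lshift k.+1 b by apply: val_inj.
      rewrite chain_arc_rl => /andP[/eqP-> /eqP->].
      by apply/orP; right; apply/imsetP; exists ord0.
    have -> : u = rshift n.+1 s by apply: val_inj.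
    have -> : v = rshift n.+1 t by apply: val_inj.
    rewrite chain_arc_rr => /eqP st.
    apply/orP; right; apply/imsetP; exists s => //.
    rewrite /g /= st; congr (_, rshift _ _).
    by apply: val_inj; rewrite /= inordK.
  - by rewrite inE => Ge [-> ->]; rewrite mem_edges chain_arc_ll.
  by move=> E; have := Eg s; rewrite -E mem_edges.
rewrite cardsU [X in (_ - #|pred_of_set X|)%N](_ : _ = set0); last first.
  apply/eqP; rewrite -subset0; apply/subsetP => e; rewrite inE.
  case/andP => /imsetP[e1 _ ->] /imsetP[s _ /(congr1 fst) /eqP].
  by rewrite /= eq_lrshift.
rewrite cards0 subn0 !card_imset ?cardsT ?card_ord //.
  by move=> s t /(congr1 fst) /rshift_inj.
move=> [a b] [a' b'] E; congr (_, _).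
  exact: (@lshift_inj _ _ _ _ (congr1 fst E)).
exact: (@lshift_inj _ _ _ _ (congr1 snd E)).
Qed.

(** The common parameter space: the parameters of the model on [G], and then
    the diagonal entries of the vertices of the path. *)
Let Om := {mpoly R[#|param M| + k.+1]}.

(** The diagonal entry of the vertex [s] of the path. *)
Definition diag_var (s : 'I_k.+1) : Om := 'X_(rshift _ s).

(** The inclusion of the parameters of the model on [G]. *)
Definition old_params : param_ring R M -> Om :=
  mmap (@mpolyC _ R) (fun r => 'X_(lshift k.+1 r)).
HB.instance Definition _ := GRing.RMorphism.copy old_params old_params.

(** Specialization of the parameters of the larger model for which all the
    edge parameters of the path are 1. *)
Definition unit_path_mx : 'M[Om]_(n.+1 + k.+1) :=
  chain_mx (map_mx old_params (compartmental_mx R M)) diag_var.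

Definition unit_path : param_ring R M' -> Om :=
  mmap (@mpolyC _ R) (param_value unit_path_mx).
HB.instance Definition _ := GRing.RMorphism.copy unit_path unit_path.

Lemma chain_mx_supp (A : nzRingType) (B : 'M[A]_n.+1) (d : 'I_k.+1 -> A) :
    (forall u v, u != v -> ~~ G v u -> B u v = 0) ->
  forall u v, u != v -> ~~ G' v u -> chain_mx B d u v = 0.
Proof.
move=> suppB u v; case: (splitP u) => [a|s] Eu; case: (splitP v) => [b|t] Ev.
- have -> : u = lshift k.+1 a by apply: val_inj.
  have -> : v = lshift k.+1 b by apply: val_inj.
  by rewrite chain_arc_ll eq_lshift block_mxEul; apply: suppB.
- have -> : u = lshift k.+1 a by apply: val_inj.
  have -> : v = rshift n.+1 t by apply: val_inj.
  by rewrite chain_arc_rl block_mxEur mxE andbC => _ /negPf->.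
- have -> : u = rshift n.+1 s by apply: val_inj.
  have -> : v = lshift k.+1 b by apply: val_inj.
  by rewrite block_mxEdl mxE.
have -> : u = rshift n.+1 s by apply: val_inj.
have -> : v = rshift n.+1 t by apply: val_inj.
by rewrite chain_arc_rr eq_rshift block_mxEdr mxE => /negPf-> /negPf->.
Qed.

Lemma map_unit_path :
  map_mx unit_path (compartmental_mx R M') = unit_path_mx.
Proof.
apply: compartmental_mx_onto; apply: chain_mx_supp => u v uv nG.
by rewrite mxE compartmental_mx_supp ?rmorph0.
Qed.

Lemma meval_old_params (a : 'I_(#|param M| + k.+1) -> R) q :
  (old_params q).@[a] = q.@[fun r => a (lshift k.+1 r)].
Proof. by rewrite meval_mmap; apply: meval_eq => r; rewrite mevalXU. Qed.

(** The edge of the path leaving the vertex [s]. *)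
Definition path_param (A : Type) (B : 'M[A]_(n.+1 + k.+1)) (s : 'I_k.+1) : A :=
  B (if val s is t.+1 then rshift n.+1 (inord t) else lshift k.+1 ord0)
    (rshift n.+1 s).

(** Rescaling the states makes the edge parameters of the path equal to 1
    without changing the input-output equation, provided that the input and
    the output are rescaled by the same factor. *)
Section Rescale.
Variable B : 'M[R]_(n.+1 + k.+1).
Hypothesis B0 : forall s, path_param B s != 0.
Hypothesis suppB : forall u v, u != v -> ~~ G' v u -> B u v = 0.
Hypothesis hj : j != ord0.

(** The scaling factors: 1 on [G] except at the output, partial products of the
    edge parameters on the path, and the whole product at the input and at the
    output. *)
Definition scale (w : 'I_(n.+1 + k.+1)) : R :=
  match split w with
  | inl v => if v == j then \prod_s path_param B s else 1
  | inr s => \prod_(t < k.+1 | (t <= s)%N) path_param B t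
  end.

Lemma scale_neq0 w : scale w != 0.
Proof.
rewrite /scale; case: split => [v|s]; last by apply/prodf_neq0 => t _.
by case: ifP => _; [apply/prodf_neq0 => t _|rewrite oner_neq0].
Qed.

Lemma scale_io : scale (rshift n.+1 ord_max) = scale (lshift k.+1 j).
Proof.
rewrite /scale split_lshift split_rshift eqxx.
by apply: eq_bigl => t; rewrite -ltnS ltn_ord.
Qed.

(** The compartmental matrix in the rescaled states. *)
Definition rescaled : 'M[R]_(n.+1 + k.+1) :=
  \matrix_(u, v) (scale u * B u v / scale v).

Lemma rescaledE :
  rescaled = chain_mx (ulsubmx rescaled) (fun s => B (rshift _ s) (rshift _ s)).
Proof.
apply/matrixP => u v; case: (splitP u) => [a|s] Eu; case: (splitP v) => [b|t] Ev.
- have -> : u = lshift k.+1 a by apply: val_inj.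
  have -> : v = lshift k.+1 b by apply: val_inj.
  by rewrite block_mxEul [RHS]mxE [RHS]mxE.
- have -> : u = lshift k.+1 a by apply: val_inj.
  have -> : v = rshift n.+1 t by apply: val_inj.
  rewrite block_mxEur !mxE; case: eqP => [->|/eqP a0]; last first.
    rewrite suppB ?mulr0 ?mul0r // ?eq_lrshift // chain_arc_rl.
    by rewrite (negPf a0) andbF.
  case: eqP => [->|/eqP t0]; last first.
    rewrite suppB ?mulr0 ?mul0r // ?eq_lrshift // chain_arc_rl.
    by rewrite (negPf t0).
  rewrite /scale split_lshift split_rshift eq_sym (negPf hj) mul1r.
  rewrite (bigD1 ord0) //= big1 => [|x /andP[]]; last first.
    by rewrite leqn0 => x0 /negP[]; apply/eqP/val_inj/eqP.
  by rewrite mulr1 divff //; apply: (B0 ord0).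
- have -> : u = rshift n.+1 s by apply: val_inj.
  have -> : v = lshift k.+1 b by apply: val_inj.
  by rewrite block_mxEdl !mxE suppB ?mulr0 ?mul0r // ?eq_rlshift // chain_arc_lr.
have -> : u = rshift n.+1 s by apply: val_inj.
have -> : v = rshift n.+1 t by apply: val_inj.
rewrite block_mxEdr !mxE; case: eqP => [->|/eqP st].
  by rewrite mulrAC divff ?mul1r ?scale_neq0.
case: eqP => [ts|/eqP nts]; last first.
  by rewrite suppB ?mulr0 ?mul0r // ?eq_rshift // chain_arc_rr.
have := scale_neq0 (rshift n.+1 t); rewrite /scale !split_rshift.
have -> : \prod_(x < k.+1 | (x <= t)%N) path_param B x =
    B (rshift n.+1 s) (rshift n.+1 t) *
    \prod_(x < k.+1 | (x <= s)%N) path_param B x.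
  rewrite (bigD1 t) //=; congr (_ * _).
    rewrite /path_param /= ts; congr (B (rshift _ _) _); apply: val_inj.
    by rewrite /= inordK.
  by apply: eq_bigl => x; rewrite andbC -val_eqE -ltn_neqAle /= ts ltnS.
by rewrite [X in X / _]mulrC => /divff.
Qed.

Lemma restr_rescaled (H : {set 'I_(n.+1 + k.+1)}) :
  restr_mx H rescaled = \matrix_(s, t)
    (scale (enum_val s) * restr_mx H B s t / scale (enum_val t)).
Proof. by apply/matrixP => s t; rewrite !mxE. Qed.

Lemma char_poly_rescaled (H : {set 'I_(n.+1 + k.+1)}) :
  char_poly (restr_mx H rescaled) = char_poly (restr_mx H B).
Proof.
rewrite restr_rescaled char_poly_conj // => s; exact: scale_neq0.
Qed.

Lemma cofactor_rescaled (H : {set 'I_(n.+1 + k.+1)}) (s t : 'I_#|H|) :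
    enum_val s = rshift n.+1 ord_max -> enum_val t = lshift k.+1 j ->
  cofactor (char_poly_mx (restr_mx H rescaled)) s t =
  cofactor (char_poly_mx (restr_mx H B)) s t.
Proof.
move=> Es Et; rewrite restr_rescaled cofactor_conj ?Es ?Et ?scale_io //.
by move=> x; apply: scale_neq0.
Qed.

End Rescale.

Lemma unit_path_lhs : connect G ord0 j ->
  map_poly unit_path (io_lhs R M' (lshift k.+1 j)) =
  map_poly old_params (io_lhs R M j) * \prod_s ('X - (diag_var s)%:P).
Proof.
move=> Gj; rewrite (map_io_lhs map_unit_path).
rewrite (map_io_lhs (erefl (map_mx old_params (compartmental_mx R M)))).
apply: char_poly_chain => [v|s]; first exact: reach_lshift.
exact: reach_rshift.
Qed.

Lemma reach_posK (n0 : nat) (M0 : model n0) (l v : 'I_n0) :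
  v \in output_reachable M0 l -> enum_val (reach_pos M0 l v) = v.
Proof. exact: enum_rankK_in. Qed.

Lemma unit_path_rhs : connect G ord0 j ->
  map_poly unit_path (io_rhs R M' (lshift k.+1 j) (rshift n.+1 ord_max)) =
  map_poly old_params (io_rhs R M j ord0).
Proof.
move=> Gj; rewrite (map_io_rhs map_unit_path).
rewrite (map_io_rhs (erefl (map_mx old_params (compartmental_mx R M)))).
have Hj v : connect G v j -> enum_val (reach_pos M j v) = v.
  by move=> Gv; apply: reach_posK; rewrite inE.
apply: cofactor_chain => [v|s|||]; first exact: reach_lshift.
- exact: reach_rshift.
- exact: Hj.
- by apply: reach_posK; apply: reach_rshift.
by rewrite Hj // reach_posK // mem_output_reachable.
Qed.

(** The new diagonal entries are independent of the coefficients of the model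
    on [G], which involve other variables. *)
Lemma indep_diag_vars (B : seq {fraction Om}) :
    {subset B <= [seq tofrac (old_params q) | q <- coeffs R M]} ->
    indep (@const_frac R _) B ->
  indep (@const_frac R _) ([seq tofrac (diag_var s) | s <- enum 'I_k.+1] ++ B).
Proof.
move=> sB iB; elim: (enum _) (enum_uniq 'I_k.+1) => //= s D IH /andP[sD uD].
split; last exact: IH.
apply: not_cl_var => x; rewrite mem_cat => /orP[/mapP[t tD ->]|/sB/mapP[q _ ->]].
  exists (diag_var t) => //; rewrite /isolate_var mmapX mmap1U eq_rshift.
  by case: eqP => // ts; rewrite -ts tD in sD.
exists (old_params q) => //.
apply: (@mpoly_rmorph_ext _ _ _ (isolate_var (rshift _ s) \o old_params)
  (@polyC _ \o @tofrac _ \o old_params)) => [c|r] /=.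
  by rewrite /old_params mmapC /isolate_var mmapC.
rewrite /old_params mmapX mmap1U /isolate_var mmapX mmap1U.
by rewrite eq_lrshift.
Qed.

(** The transcendence degree grows by the length of the path. *)
Lemma tbasis_unit_path B B' : connect G ord0 j ->
    tbasis (@const_frac R _) [seq tofrac (old_params q) | q <- coeffs R M] B ->
    tbasis (@const_frac R _) [seq tofrac (unit_path q) | q <- coeffs R M'] B' ->
  size B' = (k.+1 + size B)%N.
Proof.
move=> Gj tB tB'; have [iB sB _] := tB.
have Gj' : connect G' (rshift n.+1 ord_max) (lshift k.+1 j).
  by have := reach_rshift ord_max Gj; rewrite inE.
have gens := coeffs_gens (@const_frac R _) (@tofrac _ \o old_params) Gj.
have gens' := coeffs_gens (@const_frac R _) (@tofrac _ \o unit_path) Gj'.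
rewrite (tbasis_mul_linear _ gens _ tB (indep_diag_vars sB iB) tB').
- by rewrite size_map size_enum_ord.
- exact/monic_neq0/monic_map/char_poly_monic.
have -> : \prod_(x <- [seq tofrac (diag_var s) | s <- enum 'I_k.+1]) ('X - x%:P)
   = map_poly (@tofrac _) (\prod_s ('X - (diag_var s)%:P)).
  rewrite big_map big_enum rmorph_prod; apply: eq_bigr => s _.
  by rewrite rmorphB /= map_polyX map_polyC.
move: gens'; rewrite !map_poly_comp unit_path_lhs // unit_path_rhs //.
by rewrite rmorphM.
Qed.

(** The product of the edge parameters along the path. *)
Definition path_prod : param_ring R M' :=
  \prod_s path_param (compartmental_mx R M') s.

Lemma path_prod_neq0 : path_prod != 0.
Proof.
apply/eqP => /(congr1 unit_path); rewrite /path_prod rmorph_prod rmorph0.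
rewrite big1 => [/eqP|s _]; first by rewrite oner_eq0.
transitivity (path_param unit_path_mx s).
  by rewrite -map_unit_path /path_param [RHS]mxE.
rewrite /path_param; case: s => [[|t] lt_t] /=.
  by rewrite block_mxEur mxE.
by rewrite block_mxEdr mxE -val_eqE /= inordK ?(ltnW lt_t) // ltn_eqF ?eqxx.
Qed.

(** When no edge parameter of the path vanishes, the coefficients take values
    that are already taken with edge parameters 1 on the path. *)
Lemma coeffs_rescale (a : 'I_#|param M'| -> R) : j != ord0 ->
    path_prod.@[a] != 0 ->
  exists b, forall q, q \in coeffs R M' -> q.@[a] = (unit_path q).@[b].
Proof.
move=> j0; rewrite /path_prod rmorph_prod /= => /prodf_neq0 a0.
have [B mapB] : exists B, map_mx (meval a) (compartmental_mx R M') = B.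
  by eexists.
have B0 s : path_param B s != 0.
  have -> : path_param B s = (path_param (compartmental_mx R M') s).@[a].
    by rewrite -mapB /path_param [LHS]mxE.
  exact: (a0 s isT).
have suppB u v : u != v -> ~~ G' v u -> B u v = 0.
  by move=> uv nG; rewrite -mapB mxE compartmental_mx_supp ?rmorph0.
have EB := rescaledE B0 suppB j0.
pose Bo := ulsubmx (rescaled B).
have suppBo u v : u != v -> ~~ G v u -> Bo u v = 0.
  move=> uv nG.
  have -> : Bo u v = rescaled B (lshift k.+1 u) (lshift k.+1 v).
    by rewrite [LHS]mxE [LHS]mxE.
  by rewrite mxE suppB ?mulr0 ?mul0r // ?eq_lshift // chain_arc_ll.
pose b (r : 'I_(#|param M| + k.+1)) := match split r with
  | inl r' => @param_value _ G ord0 j R Bo r'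
  | inr s => B (rshift n.+1 s) (rshift n.+1 s) end.
have Eb : map_mx (meval b \o unit_path) (compartmental_mx R M') = rescaled B.
  rewrite map_mx_comp map_unit_path EB /unit_path_mx /chain_mx map_block_mx.
  congr block_mx.
  - rewrite -map_mx_comp -/Bo.
    rewrite -[RHS](@compartmental_mx_onto R _ G ord0 j R idfun Bo suppBo).
    apply/matrixP => u v; rewrite !mxE /= meval_old_params.
    by apply: meval_eq => r; rewrite /b split_lshift.
  - by apply/matrixP => u v; rewrite !mxE /= rmorph_nat.
  - by rewrite map_mx0.
  apply/matrixP => u v; rewrite !mxE /=; case: eqP => _; last exact: rmorph_nat.
  by rewrite mevalXU /b split_rshift.
exists b => q coeffs_q.
have G'j : connect G' (rshift n.+1 ord_max) (lshift k.+1 j).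
  by apply: contraLR coeffs_q => /(@coeffs_not_connect R)->.
case/mem_coeffs: coeffs_q => -[l ->].
  transitivity (map_poly (meval a) (io_lhs R M' (lshift k.+1 j)))`_l.
    by rewrite coef_map.
  rewrite (map_io_lhs mapB) -(char_poly_rescaled B0).
  by rewrite -(map_io_lhs Eb) coef_map.
transitivity (map_poly (meval a)
    (io_rhs R M' (lshift k.+1 j) (rshift n.+1 ord_max)))`_l.
  by rewrite coef_map.
rewrite (map_io_rhs mapB) -(cofactor_rescaled B0).
- by rewrite -(map_io_rhs Eb) coef_map.
- by apply: reach_posK; rewrite inE.
exact/reach_posK/mem_output_reachable.
Qed.

End ChainModel.

Theorem proposition3p30 (R : realType) (n k : nat) (G : digraph n.+1)
    (j : 'I_n.+1) (hj : j != ord0) :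
  expected_dimension R (full_leak_model G ord0 j) ->
  expected_dimension R
    (full_leak_model (chain_graph k.+1 G)
       (rshift n.+1 (@ord_max k)) (lshift k.+1 j)).
Proof.
rewrite /expected_dimension /= card_chain_edges !cards2.
rewrite [ord0 == j]eq_sym hj eq_rlshift /= => dimM.
pose old q : {mpoly R[_]} := @old_params R n k G j q.
pose new q : {mpoly R[_]} := @unit_path R n k G j q.
(* The same set, parametrized by the common parameter space. *)
have {}dimM : has_dim (poly_image (fun s => old (tnth (in_tuple
    (coeffs R (full_leak_model G ord0 j))) s))) (#|edges G| + 2).
  apply: has_dim_dense dimM; first exact: oner_neq0.
    move=> _ [a ->]; exists (fun r => if split r is inl r' then a r' else 0).
    apply/funext => s; rewrite meval_old_params; apply: meval_eq => r.
    by rewrite split_lshift.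
  move=> a _; exists (fun r => a (lshift k.+1 r)); apply/funext => s.
  exact: meval_old_params.
case/has_dim_image: dimM => B.
rewrite (map_tnth_in_tuple _ (@tofrac _ \o old)) => tB sB.
(* Without a path to the output there are no coefficients, and the dimension
   would be 0, which is less than 2. *)
have Gj : connect G ord0 j.
  apply: contraT => /(@coeffs_not_connect R) E; move: tB sB; rewrite E.
  case: B => [|x B] [_ sB _] /=; first by rewrite addnC.
  by have := sB x (mem_head _ _).
have [B' tB'] := tbasis_exists (@const_frac R _)
  [seq tofrac (new q) | q <- coeffs R (full_leak_model (chain_graph k.+1 G)
       (rshift n.+1 (@ord_max k)) (lshift k.+1 j))].
have dim' : has_dim (poly_image (fun s => new (tnth (in_tuple (coeffs R
    (full_leak_model (chain_graph k.+1 G) (rshift n.+1 (@ord_max k))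
       (lshift k.+1 j)))) s))) (#|edges G| + k.+1 + 2).
  apply/has_dim_image; exists B'.
    by rewrite (map_tnth_in_tuple _ (@tofrac _ \o new)).
  by rewrite (tbasis_unit_path Gj tB tB') sB addnCA addnA.
apply: (has_dim_dense (path_prod_neq0 R k G j)) dim' => [_ [b ->]|a a0].
  exists (fun r => (param_value (unit_path_mx R k G j) r).@[b]).
  by apply/funext => s; apply: meval_mmap.
have [b Eb] := coeffs_rescale hj a0; exists b; apply/funext => s.
by apply: Eb; apply: mem_tnth.
Qed.
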